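(* Let $K_4-e$ denote the graph obtained from $K_4$ by removing one edge. Then $[C_6]=\{C_6,D_6,(K_4-e)\cup K_2\}$, and $[C_{2n}]=\{C_{2n},D_{2n}\}$ for all integers $n\ge 2$ with $n\neq 3$.
   Context: All graphs are finite, undirected and simple, considered up to isomorphism. The independence polynomial of a graph $G$ is $i(G,x)=\sum_{k\ge 0} i_k x^k$, where $i_k$ is the number of independent sets (vertex sets inducing no edges) of size $k$. The independence equivalence class $[G]$ is the set of graphs $H$ with $i(H,x)=i(G,x)$. $C_n$ is the cycle on $n$ vertices, $\cup$ denotes disjoint union, and for $n\ge 3$, $D_n$ is the graph on vertices $u_1,\dots,u_n$ with edges $u_1u_2,u_1u_3,u_2u_3$ and $u_ju_{j+1}$ for $3\le j\le n-1$ (a triangle with a pendant path attached at one vertex, $n$ vertices in total). *)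

(* Defs.v *)
From HB Require Import structures.
From mathcomp Require Import all_boot all_order all_algebra.

Set Implicit Arguments.
Unset Strict Implicit.
Unset Printing Implicit Defensive.

Import GRing.Theory.

Record sgraph := SGraph {
  vertex :> finType;
  adj : rel vertex;
  adj_sym : symmetric adj;
  adj_irr : irreflexive adj }.

Arguments adj {s}.

Definition iso (G H : sgraph) : Prop :=
  exists f : G -> H, bijective f /\ forall x y : G, adj (f x) (f y) = adj x y.

Definition rel_adj (T : finType) (r : rel T) : rel T :=
  fun x y => (x != y) && (r x y || r y x).

Lemma rel_adj_sym (T : finType) (r : rel T) : symmetric (rel_adj r).
Proof. by move=> x y; rewrite /rel_adj eq_sym orbC. Qed.

Lemma rel_adj_irr (T : finType) (r : rel T) : irreflexive (rel_adj r).
Proof. by move=> x; rewrite /rel_adj eqxx. Qed.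

Definition graph_of_rel (T : finType) (r : rel T) : sgraph :=
  SGraph (rel_adj_sym r) (rel_adj_irr r).

Definition complete (n : nat) : sgraph :=
  graph_of_rel (fun _ _ : 'I_n => true).

(* The cycle on n vertices for n >= 3 (K_1 and K_2 for n = 1, 2). *)
Definition cycle_graph (n : nat) : sgraph :=
  graph_of_rel (fun i j : 'I_n => j == i.+1 %% n :> nat).

(* Meant for n >= 3. Vertex u_k is the ordinal k - 1: the first disjunct is
   the triangle u_1 u_2 u_3, the second the path u_3 u_4 ... u_n. *)
Definition D_graph (n : nat) : sgraph :=
  graph_of_rel
    (fun i j : 'I_n => (i < j < 3) || (2 <= i) && (j == i.+1 :> nat)).

Definition del_edge (G : sgraph) (u v : G) : sgraph :=
  graph_of_rel (fun x y : G => adj x y && ([set x; y] != [set u; v])).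

Definition K4_minus_edge : sgraph :=
  @del_edge (complete 4) (@inord 3 0) (@inord 3 1).

Definition disjoint_union (G H : sgraph) : sgraph :=
  graph_of_rel (fun a b : (G + H)%type =>
    match a, b with
    | inl x, inl y => adj x y
    | inr x, inr y => adj x y
    | _, _ => false
    end).

Definition independent (G : sgraph) (S : {set G}) : bool :=
  [forall x in S, forall y in S, ~~ adj x y].

Definition num_indep (G : sgraph) (k : nat) : nat :=
  #|[set S : {set G} | independent S && (#|S| == k)]|.

Definition indep_poly (G : sgraph) : {poly int} :=
  \poly_(k < #|G|.+1) ((num_indep G k)%:R)%R.

Definition indep_class (G H : sgraph) : Prop := indep_poly H = indep_poly G.

(* Main.v *)
(* Comparing coefficients
   up to [X^3], a graph with the polynomial of [C_N] satisfies
   [sum_v binomial (deg v - 1) 2 = number of triangles]. The leading coefficient of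
   [C_N] for even [N] is 2, and leading coefficients multiply over components, so no
   component is a triangle or [K4]. Sharing each triangle equally among its vertices of
   degree at least 3 then shows that the identity holds vertex by vertex: degrees lie
   between 1 and 3, and a vertex of degree 3 lies either in a triangle whose other two
   vertices have degree 2, or in a component [K4 - e]. Hence every component is a path,
   a cycle, some [D_k], a [K4 - e], or two triangles joined by a path; leading
   coefficients exclude the last kind, odd cycles, odd [D_k], and even paths except
   [K2]. Exactly one component has leading coefficient 2; counting edges and vertices
   against the independence number leaves a single [C_N], a single [D_N], or
   [K2] with [K4 - e]. *)

Require Import Defs.
From HB Require Import structures.
From mathcomp Require Import all_boot all_order all_algebra.
From mathcomp Require Import zify ring lra.

Set Implicit Arguments.
Unset Strict Implicit.
Unset Printing Implicit Defensive.

Import Order.TTheory GRing.Theory Num.Theory.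
Local Open Scope ring_scope.

(** * The independence polynomial of induced subgraphs *)

(** The identity becomes local because charges are bounded one vertex at a time. Scaled to integers,
    a vertex of degree d owes 6(d-1)(d-2). It receives at most 2d(d-1) if d is at least 4, which is
    strictly less, and at most 12 if d = 3, which is exactly what it owes; an isolated vertex owes
    12 and receives nothing. A global equality therefore leaves no slack anywhere.

    The final count uses one linear functional. On a graph with n vertices, e edges and independence
    number alpha, [balance] equals 2e - 7n + 10 alpha. Every combination 2e + wn - 2(w+2) alpha
    vanishes on even cycles and takes the values -2 on K2 and 2 on K4 - e, while an odd path gets
    -4-w; w = -7 is the largest integer that puts odd paths strictly above 2. So the deficit of a K2
    can be paid only by a single K4 - e, and next to a cycle or a D graph there is room for nothing.

    Connected components are never formed. Everything is a subset of one vertex type, and the graph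
    is dismantled by repeatedly splitting off a nonempty closed set of known shape. *)

Section IndependencePolynomial.
Variable G : sgraph.
Implicit Types (x y : G) (A B S : {set G}) (s : seq G).

Definition nbr x : {set G} := [set y | adj x y].
Definition cnbr x : {set G} := x |: nbr x.

(** Indexing by subsets of one vertex type, not by induced subgraphs, keeps deletion recursions and
    splittings inside a fixed graph. *)
Definition ipol A : {poly int} :=
  \sum_(S : {set G} | (S \subset A) && independent S) 'X^#|S|.

Lemma in_cnbr x y : (y \in cnbr x) = (y == x) || adj x y.
Proof. by rewrite !inE. Qed.

Lemma ipolT : ipol setT = indep_poly G.
Proof.
apply/polyP=> k; rewrite /indep_poly coef_poly coef_sum.
under eq_bigr do rewrite coefXn.
rewrite -natr_sum -big_mkcondr sum1_card.
rewrite -[LHS](_ : (num_indep G k)%:R = _); last first.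
  congr (_%:R); rewrite /num_indep -sum1_card; rewrite -sum1_card; apply: eq_bigl => S.
  by rewrite inE unfold_in /= subsetT eq_sym.
case: ltnP => // lt_k; rewrite /num_indep; apply/eqP.
rewrite pnatr_eq0 cards_eq0; apply/eqP/setP=> S; rewrite !inE.
apply/negP=> /andP[_ /eqP kS]; move: (max_card (mem S)); rewrite kS; lia.
Qed.

Lemma independentU1 x S : x \notin S ->
  independent (x |: S) = independent S && [disjoint S & nbr x].
Proof.
move=> xS; apply/idP/andP.
  move=> /'forall_implyP H; split.
    apply/'forall_implyP => y yS; apply/'forall_implyP=> z zS.
    have /'forall_implyP := H y (setU1r _ yS); apply; exact: setU1r.
  apply/pred0P=> y /=; apply/negP=> /andP[yS]; rewrite inE => xy.
  by have /'forall_implyP /(_ y (setU1r _ yS)) := H x (setU11 _ _); rewrite xy.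
case=> /'forall_implyP H /pred0P D; apply/'forall_implyP => y yS.
apply/'forall_implyP=> z zS.
have Dx w : w \in S -> adj x w = false by move=> wS; move: (D w); rewrite /= wS inE.
case/setU1P: yS => [->|yS]; case/setU1P: zS => [->|zS].
- by rewrite adj_irr.
- by rewrite Dx.
- by rewrite adj_sym Dx.
- by have /'forall_implyP := H y yS; apply.
Qed.

Lemma ipol_mem x A : x \in A ->
  \sum_(S : {set G} | ((S \subset A) && independent S) && (x \in S)) 'X^#|S| =
  'X * ipol (A :\: cnbr x).
Proof.
move=> xA; rewrite (reindex_onto (fun S => x |: S) (fun S => S :\ x)) /=; last first.
  by move=> S /andP[_ xS]; rewrite setD1K.
rewrite /ipol big_distrr /=.
have E S : ((x |: S) :\ x == S) = (x \notin S).
  by apply/eqP/idP => [<-|/setU1K //]; rewrite !inE eqxx.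
under eq_bigl do rewrite setU11 andbT E subUset sub1set xA /=.
rewrite [RHS](eq_bigl (fun S => ((S \subset A) && independent (x |: S)) && (x \notin S))).
  by apply: eq_bigr => S /andP[_ xS]; rewrite cardsU1 xS exprS.
move=> S; case xS: (x \in S) => /=.
  rewrite andbF; apply/negP=> /andP[/subsetP /(_ x xS)].
  by rewrite inE in_cnbr eqxx.
rewrite independentU1 ?xS // andbT subsetD /cnbr disjoints_subset setCU subsetI.
rewrite -!disjoints_subset disjoint_sym disjoints1 xS /=.
by rewrite -!andbA; congr (_ && _); rewrite andbC.
Qed.

Lemma ipol_rec x A : x \in A -> ipol A = ipol (A :\ x) + 'X * ipol (A :\: cnbr x).
Proof.
move=> xA; rewrite -ipol_mem // {1}/ipol (bigID (fun S => x \in S)) /= addrC.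
congr (_ + _); apply: eq_bigl => S.
by rewrite subsetD1 -!andbA; congr (_ && _); rewrite andbC.
Qed.

Lemma ipol0 : ipol set0 = 1.
Proof.
rewrite /ipol (big_pred1 set0) ?cards0 ?expr0 // => S.
rewrite subset0 /=; case: eqP => [->|] //=.
by apply/'forall_implyP=> y; rewrite inE.
Qed.

(** Double counting of pairs of an independent set of size [k.+1] and one of its vertices: the
    coefficient form of the formula for the derivative of the independence polynomial. *)
Lemma coef_ipol_succ A k :
  (ipol A)`_k.+1 *+ k.+1 = \sum_(x in A) (ipol (A :\: cnbr x))`_k.
Proof.
transitivity (\sum_(x in A) ('X * ipol (A :\: cnbr x))`_k.+1); last first.
  by apply: eq_bigr => x _; rewrite coefXM.
under eq_bigr => x xA do rewrite -ipol_mem // coef_sum.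
rewrite (exchange_big_dep (fun S => (S \subset A) && independent S)) /=; last first.
  by move=> x S _ /andP[].
rewrite coef_sum -sumrMnl; apply: eq_bigr => S /andP[SA iS].
rewrite (eq_bigl (mem S)); last first.
  move=> x; rewrite SA iS /=; case xS: (x \in S); rewrite ?andbF ?andbT //.
  exact: (subsetP SA).
rewrite sumr_const coefXn; case: eqP => [->|] //; by rewrite !mul0rn.
Qed.

(** The two induction hypotheses concern the two sets on the right of [ipol_rec]. *)
Lemma ipol_ind (P : {set G} -> Prop) :
  P set0 -> (forall x A, x \in A -> P (A :\ x) -> P (A :\: cnbr x) -> P A) ->
  forall A, P A.
Proof.
move=> P0 PS A; have [m] := ubnP #|A|; elim: m A => // m IH A leA.
case: (set_0Vmem A) => [-> //|[x xA]]; have ltA: (#|A :\ x| < m)%N.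
  by move: leA; rewrite (cardsD1 x) xA; lia.
apply: (PS x) => //; apply: IH => //.
apply: leq_ltn_trans ltA; apply: subset_leq_card; apply: setDS.
by rewrite sub1set in_cnbr eqxx.
Qed.

Lemma coef0_ipol A : (ipol A)`_0 = 1.
Proof.
elim/ipol_ind: A => [|x A xA IH _]; first by rewrite ipol0 coefC.
by rewrite (ipol_rec xA) coefD IH coefXM addr0.
Qed.

Lemma coef1_ipol A : (ipol A)`_1 = #|A|%:Z.
Proof.
rewrite -[LHS]mulr1n coef_ipol_succ.
by under eq_bigr do rewrite coef0_ipol; rewrite sumr_const natz.
Qed.

Lemma coef2_ipol A : (ipol A)`_2 *+ 2 = \sum_(x in A) #|A :\: cnbr x|%:Z.
Proof. by rewrite coef_ipol_succ; under eq_bigr do rewrite coef1_ipol. Qed.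

Lemma coef3_ipol A :
  (ipol A)`_3 *+ 6 = \sum_(x in A) \sum_(y in A :\: cnbr x) #|A :\: cnbr x :\: cnbr y|%:Z.
Proof.
rewrite (mulrnA _ 3 2) coef_ipol_succ -sumrMnl.
by under eq_bigr do rewrite coef2_ipol.
Qed.

Lemma coef_ipol_ge0 A k : 0 <= (ipol A)`_k.
Proof.
by rewrite coef_sum sumr_ge0 // => S _; rewrite coefXn ler0n.
Qed.

Lemma ipol_neq0 A : ipol A != 0.
Proof. by apply/eqP=> A0; have := coef0_ipol A; rewrite A0 coef0. Qed.

Lemma lead_ipol_gt0 A : 0 < lead_coef (ipol A).
Proof. by rewrite lt_def lead_coef_eq0 ipol_neq0 coef_ipol_ge0. Qed.

(** Removing a vertex of [A], or its closed neighbourhood, leaves [B] intact, so both sides obey the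
    same recursion in [A]. *)
Lemma ipolU A B : (forall x y, x \in A -> y \in B -> ~~ adj x y) -> [disjoint A & B] ->
  ipol (A :|: B) = ipol A * ipol B.
Proof.
elim/ipol_ind: A => [|x A xA IH1 IH2] nAB dAB; first by rewrite set0U ipol0 mul1r.
have xB : x \notin B by rewrite (disjointFr dAB).
rewrite (ipol_rec xA) (@ipol_rec x (A :|: B)) ?inE ?xA // mulrDl -mulrA.
have sub (C : {set G}) : [disjoint A :\: C & B].
  by apply: disjointWl dAB; apply: subsetDl.
rewrite -IH1 -?IH2 //; try by move=> y z; rewrite inE => /andP[_]; apply: nAB.
congr (ipol _ + 'X * ipol _); apply/setP=> y; rewrite !inE.
  by case: eqP => [->|//]; rewrite (negPf xB).
case yB: (y \in B); rewrite ?orbT ?orbF // (negPf (nAB _ _ xA yB)) !orbF andbT.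
by case: eqP yB xB => // -> ->.
Qed.

Definition closed_set A := forall x y, x \in A -> adj x y -> y \in A.

Lemma closed_setC A : closed_set A -> closed_set (~: A).
Proof.
move=> cA x y; rewrite !inE => nA xy; apply: contra nA => /cA; apply.
by rewrite adj_sym.
Qed.

Lemma closed_setD A B : closed_set A -> closed_set B -> closed_set (A :\: B).
Proof.
move=> cA /closed_setC cB x y; rewrite !inE => /andP[xB xA] xy.
by rewrite (cA x) // andbT; have := cB x y; rewrite !inE; apply.
Qed.

Lemma ipol_closed A B : closed_set A -> closed_set B -> A \subset B ->
  ipol B = ipol A * ipol (B :\: A).
Proof.
move=> cA cB AB; rewrite -ipolU.
- by congr ipol; rewrite setDE setUIr setUCr setIT; apply/esym/setUidPr.
- move=> x y xA; rewrite inE => /andP[yA _]; apply: contra yA; exact: cA.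
- by rewrite -setI_eq0 setIDA [A :&: B]setIC -setIDA setDv setI0.
Qed.

Definition iseq s := ipol [set x in s].

Lemma iseq_nil : iseq [::] = 1.
Proof. by rewrite /iseq -ipol0; congr ipol; apply/setP=> x; rewrite !inE. Qed.

Lemma iseq_cons x s : x \notin s ->
  iseq (x :: s) = iseq s + 'X * iseq [seq y <- s | ~~ adj x y].
Proof.
move=> xs; rewrite /iseq (@ipol_rec x) ?inE ?eqxx //.
congr (ipol _ + 'X * ipol _); apply/setP=> y; rewrite !inE.
  by case: eqP => [->|//]; rewrite (negPf xs).
rewrite mem_filter; case: (eqVneq y x) => [->|_] //=.
by rewrite (negPf xs) andbF.
Qed.

End IndependencePolynomial.

Arguments closed_set {G}.

(** * Polynomials of paths and cycles *)

Lemma coefXMS (R : nzRingType) (P : {poly R}) k : ('X * P)`_k.+1 = P`_k.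
Proof. by rewrite coefXM. Qed.

(** For an independence polynomial, [d] is the independence number and [l] the number of maximum
    independent sets. *)
Definition deg_lead (P : {poly int}) (d l : nat) :=
  (size P = d.+1) /\ (lead_coef P = l%:R).

Lemma deg_lead_coef (P : {poly int}) d l : (0 < l)%N -> P`_d = l%:R ->
  (forall j, (d < j)%N -> P`_j = 0) -> deg_lead P d l.
Proof.
move=> l0 Pd P0; have sP : size P = d.+1.
  apply/eqP; rewrite eqn_leq; apply/andP; split; first exact/leq_sizeP.
  by rewrite ltnNge; apply/negP=> /leq_sizeP /(_ d (leqnn _)); rewrite Pd; lia.
by split; rewrite // /lead_coef sP.
Qed.

Lemma deg_lead_linear k : (0 < k)%N -> deg_lead ('X *+ k + 1) 1 k.
Proof.
move=> k0; apply: deg_lead_coef => //; first by rewrite !coefE addr0.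
by case=> [|[|j]] // _; rewrite !coefE mul0rn addr0.
Qed.

Lemma deg_lead_diamond : deg_lead ('X * 'X + 'X *+ 4 + 1) 2 1.
Proof.
apply: deg_lead_coef => //; first by rewrite !(coefD, coefXM, coefMn, coefX, coef1).
by case=> [|[|[|j]]] // _; rewrite !(coefD, coefXM, coefMn, coefX, coef1).
Qed.

Lemma deg_leadD P Q d l m : (0 < l)%N -> deg_lead P d l -> deg_lead Q d m ->
  deg_lead (P + Q) d (l + m).
Proof.
move=> l0 [sP lP] [sQ lQ].
apply: deg_lead_coef; first by rewrite addn_gt0 l0.
  by rewrite coefD natrD -lP -lQ /lead_coef sP sQ.
by move=> j dj; rewrite coefD !nth_default ?addr0 ?sP ?sQ.
Qed.

Lemma deg_leadDl P Q d e l m : (e < d)%N -> deg_lead P d l -> deg_lead Q e m ->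
  deg_lead (P + Q) d l.
Proof.
move=> ed [sP lP] [sQ lQ]; have lt : (size Q < size P)%N by rewrite sP sQ.
by split; rewrite ?size_polyDl ?lead_coefDl.
Qed.

Lemma deg_leadX P d l : deg_lead P d l -> deg_lead ('X * P) d.+1 l.
Proof.
move=> [sP lP]; split; last by rewrite mulrC lead_coefMX.
by rewrite mulrC size_mulX ?sP // -size_poly_gt0 sP.
Qed.

Fixpoint path_pol k : {poly int} :=
  match k with
  | 0 => 1
  | 1 => 1 + 'X
  | (k.+1 as k1).+1 => path_pol k1 + 'X * path_pol k
  end.

Arguments path_pol : simpl nomatch.

(** The index is shifted by 3: this belongs to the cycle on k+3 vertices. It also belongs to the D
    graph on k+3 vertices, since deleting u_1 leaves a path on k+2 vertices and deleting its closed
    neighbourhood one on k. *)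
Definition cycle_pol k := path_pol k.+2 + 'X * path_pol k.

Lemma path_polSS k : path_pol k.+2 = path_pol k.+1 + 'X * path_pol k.
Proof. by []. Qed.

Lemma deg_lead_path j : deg_lead (path_pol j.*2) j j.+1 /\
  deg_lead (path_pol j.*2.+1) j.+1 1.
Proof.
elim: j => [|j [IH1 IH2]].
  split; first by split; rewrite ?size_poly1 ?lead_coef1.
  by split; rewrite /= addrC -(polyC1) ?size_XaddC ?lead_coefXaddC.
have E : deg_lead (path_pol j.+1.*2) j.+1 j.+2.
  rewrite doubleS path_polSS -[j.+2]/(1 + j.+1)%N.
  by apply: deg_leadD => //; apply: deg_leadX.
split => //; rewrite doubleS path_polSS -doubleS addrC.
by apply: deg_leadDl E => //; apply: deg_leadX.
Qed.

Lemma deg_lead_cycle j : deg_lead (cycle_pol j.*2) j.+1 (j.*2 + 3) /\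
  deg_lead (cycle_pol j.*2.+1) j.+2 2.
Proof.
have [E0 O0] := deg_lead_path j; have [E1 O1] := deg_lead_path j.+1.
rewrite /cycle_pol; split.
  rewrite -doubleS (_ : _ + 3 = j.+2 + j.+1)%N; last lia.
  by apply: deg_leadD => //; apply: deg_leadX.
rewrite -doubleS -[2%N]/(1 + 1)%N.
by apply: deg_leadD => //; apply: deg_leadX.
Qed.

(** The polynomial of two triangles joined by a path, on k+6 vertices: deleting a vertex of degree 2
    in one triangle leaves a D graph on k+5 vertices, deleting its closed neighbourhood one on
    k+3. *)
Lemma deg_lead_dumbbell k : exists d l,
  deg_lead (cycle_pol k.+2 + 'X * cycle_pol k) d l /\ (2 < l)%N.
Proof.
rewrite -(odd_double_half k); case: (odd k) => /=; rewrite ?add1n ?add0n -?doubleS.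
  exists k./2.+3, 4%N; split=> //; rewrite -[4%N]/(2 + 2)%N.
  apply: deg_leadD => //; first by case: (deg_lead_cycle k./2.+1).
  by apply: deg_leadX; case: (deg_lead_cycle k./2).
exists k./2.+2, (k./2.+1.*2 + 3 + (k./2.*2 + 3))%N; split; last lia.
apply: deg_leadD; first lia; first by case: (deg_lead_cycle k./2.+1).
by apply: deg_leadX; case: (deg_lead_cycle k./2).
Qed.

(** * Coefficients of degree at most 3 of paths and cycles *)

Lemma coef0_path k : (path_pol k)`_0 = 1.
Proof.
suff: (path_pol k)`_0 = 1 /\ (path_pol k.+1)`_0 = 1 by case.
elim: k => [|k [IH1 IH2]]; first by rewrite /= coefD !coefE.
by split=> //; rewrite path_polSS coefD coefXM IH2.
Qed.

Lemma coef1_path k : (path_pol k)`_1 = k%:R.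
Proof.
suff: (path_pol k)`_1 = k%:R /\ (path_pol k.+1)`_1 = k.+1%:R by case.
elim: k => [|k [IH1 IH2]]; first by rewrite /= coefD !coefE.
by split=> //; rewrite path_polSS coefD coefXMS IH2 coef0_path; ring.
Qed.

Lemma coef2_path k : (path_pol k.+1)`_2 *+ 2 = k%:R * (k%:R - 1).
Proof.
suff: (path_pol k.+1)`_2 *+ 2 = k%:R * (k%:R - 1) /\
      (path_pol k.+2)`_2 *+ 2 = k.+1%:R * (k.+1%:R - 1) by case.
elim: k => [|k [IH1 IH2]]; first by rewrite /= !(coefD, coefXM, coefE) /=.
split=> //; rewrite path_polSS coefD coefXMS mulrnDl IH2 coef1_path; ring.
Qed.

(** On m vertices the closed form is (m-2)(m-3)(m-4), which is wrong for m = 0 and m = 1; hence the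
    shift of the index. *)
Lemma coef3_path k : (path_pol k.+2)`_3 *+ 6 = k%:R * (k%:R - 1) * (k%:R - 2).
Proof.
suff: (path_pol k.+2)`_3 *+ 6 = k%:R * (k%:R - 1) * (k%:R - 2) /\
      (path_pol k.+3)`_3 *+ 6 = k.+1%:R * (k.+1%:R - 1) * (k.+1%:R - 2) by case.
elim: k => [|k [IH1 IH2]]; first by rewrite /= !(coefD, coefXM, coefE) /=.
split=> //; rewrite path_polSS coefD coefXMS mulrnDl IH2 (mulrnA _ 2 3) coef2_path; ring.
Qed.

Lemma coef1_cycle k : (cycle_pol k)`_1 = (k + 3)%:R.
Proof. rewrite coefD coefXMS coef1_path coef0_path; ring. Qed.

Lemma coef2_cycle k : (cycle_pol k)`_2 *+ 2 = (k + 3)%:R * k%:R.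
Proof. rewrite coefD coefXMS mulrnDl coef2_path coef1_path; ring. Qed.

(** The index [k.+1] starts at the cycle on four vertices: for a triangle the closed form
    n(n-4)(n-5) is 6 instead of 0, and the degree-triangle identity itself fails there. *)
Lemma coef3_cycle k : (cycle_pol k.+1)`_3 *+ 6 = (k + 4)%:R * k%:R * (k%:R - 1).
Proof.
rewrite coefD coefXMS mulrnDl coef3_path (mulrnA _ 2 3) coef2_path; ring.
Qed.

(* The first two terms form the second power sum of the inverse roots, which is
   additive under products of polynomials with constant coefficient 1, as are the
   coefficient of X and the degree. The weights make [K2], an even cycle, [K4 - e]
   and an odd path have balance -2, 0, 2 and 3, respectively. *)
Definition balance (P : {poly int}) : int :=
  P`_1 ^+ 2 - P`_2 *+ 2 - P`_1 *+ 8 + (size P).-1%:R *+ 10.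

Lemma balance1 : balance 1 = 0.
Proof. by rewrite /balance !coefC size_poly1. Qed.

Lemma balanceM (P Q : {poly int}) : P`_0 = 1 -> Q`_0 = 1 -> balance (P * Q) = balance P + balance Q.
Proof.
move=> P0 Q0; have nz (R : {poly int}) : R`_0 = 1 -> R != 0.
  by move=> R0; apply/eqP=> RE; move: R0; rewrite RE coef0.
have sP : (0 < size P)%N by rewrite size_poly_gt0 nz.
have sQ : (0 < size Q)%N by rewrite size_poly_gt0 nz.
rewrite /balance size_mul ?nz // !coefM !big_ord_recr !big_ord0 /= P0 Q0.
have -> : (size P + size Q).-2%:R = (size P).-1%:R + (size Q).-1%:R :> int.
  by rewrite -natrD; congr (_%:R); lia.
ring.
Qed.

Lemma balance_path_even j : balance (path_pol j.+1.*2) = -2.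
Proof.
have [[sz _] _] := deg_lead_path j.+1.
rewrite /balance sz doubleS coef2_path coef1_path /=.
rewrite -?mul2n; ring.
Qed.

Lemma balance_path_odd j : balance (path_pol j.*2.+1) = 3.
Proof.
have [_ [sz _]] := deg_lead_path j.
rewrite /balance sz coef2_path coef1_path /= -?mul2n; ring.
Qed.

Lemma balance_cycle j : balance (cycle_pol j.*2.+1) = 0.
Proof.
have [_ [sz _]] := deg_lead_cycle j.
rewrite /balance sz coef2_cycle coef1_cycle /= -?mul2n; ring.
Qed.

Lemma balance_diamond : balance ('X * 'X + 'X *+ 4 + 1) = 2.
Proof.
have [sz _] := deg_lead_diamond.
by rewrite /balance sz !(coefD, coefXM, coefMn, coefX, coef1).
Qed.

(** * The degree-triangle identity *)

Section Degrees.
Variable G : sgraph.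
Implicit Types (x y z v : G).

Definition deg x := #|nbr x|.

Definition triangle x y z := [&& adj x y, adj y z & adj x z].

(** Ordered triples, so each triangle counts six times. *)
Definition num_triangles : nat := \sum_x \sum_y \sum_z triangle x y z.

Lemma card_cnbr x : #|cnbr x| = (deg x).+1.
Proof. by rewrite cardsU1 inE adj_irr. Qed.

Lemma cnbr_sym x y : (y \in cnbr x) = (x \in cnbr y).
Proof. by rewrite !in_cnbr adj_sym eq_sym. Qed.

Lemma PoszSum (I : Type) (r : seq I) (P : pred I) (f : I -> nat) :
  (\sum_(i <- r | P i) f i)%N%:Z = \sum_(i <- r | P i) (f i)%:Z.
Proof. exact: (big_morph Posz PoszD). Qed.

Lemma sum_const_int (c : int) : \sum_(x : G) c = #|G|%:Z * c.
Proof. by rewrite sumr_const -mulr_natl natz. Qed.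

Lemma card_setC_cnbr2 x y : #|[set: G] :\: cnbr x :\: cnbr y|%:Z =
  #|G|%:Z - #|cnbr x|%:Z - #|cnbr y|%:Z + #|cnbr x :&: cnbr y|%:Z :> int.
Proof.
have := cardsC (cnbr x :|: cnbr y); have := cardsU (cnbr x) (cnbr y).
have := subset_leq_card (subsetIl (cnbr x) (cnbr y)).
have -> : [set: G] :\: cnbr x :\: cnbr y = ~: (cnbr x :|: cnbr y).
  by rewrite !setDE setTI setCU.
lia.
Qed.

Lemma sum_cnbr (f : G -> int) :
  \sum_x \sum_(y in cnbr x) f y = \sum_x #|cnbr x|%:Z * f x.
Proof.
rewrite (exchange_big_dep xpredT) //=; apply: eq_bigr => y _.
rewrite (eq_bigl (mem (cnbr y))); last by move=> x; rewrite cnbr_sym.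
by rewrite sumr_const -mulr_natl natz.
Qed.

Lemma sum_card_cnbrI x :
  \sum_y #|cnbr x :&: cnbr y|%:Z = \sum_(y in cnbr x) #|cnbr y|%:Z :> int.
Proof.
under eq_bigr => y _.
  rewrite -sum1_card PoszSum (eq_bigl (fun z => (z \in cnbr x) && (y \in cnbr z))).
    over.
  by move=> z; rewrite /= in_setI; congr (_ && _); apply: cnbr_sym.
rewrite (exchange_big_dep (mem (cnbr x))) /=; last by move=> y z _ /andP[].
apply: eq_bigr => z zx; under eq_bigl do rewrite zx /=.
rewrite sumr_const; exact: natz.
Qed.

(** The 2 stands for [x] and [y] themselves; any other common element completes a triangle on the
    edge. *)
Lemma card_cnbrI_adj x y : adj x y -> #|cnbr x :&: cnbr y| = (\sum_z triangle x y z).+2.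
Proof.
move=> xy; have nxy : x != y by apply: contraTneq xy => ->; rewrite adj_irr.
have -> : cnbr x :&: cnbr y = x |: (y |: (nbr x :&: nbr y)).
  apply/setP=> z; rewrite !inE.
  case: (eqVneq z x) => [->|_] /=; first by rewrite (adj_sym y) xy orbT.
  by case: (eqVneq z y) => [->|_] //=; rewrite xy.
rewrite !cardsU1 !inE !adj_irr (negPf nxy) !andbF /= !add1n -sum1_card -big_mkcond.
congr _.+2; apply: eq_bigl => z.
by rewrite !inE /triangle xy andbC.
Qed.

Lemma sum_cnbrI_cnbr : \sum_(x : G) \sum_(y in cnbr x) #|cnbr x :&: cnbr y|%:Z =
  #|G|%:Z + (\sum_(x : G) deg x)%:Z * 3 + num_triangles%:Z :> int.
Proof.
(* The term [y = x] contributes [deg x + 1]; each neighbour contributes 2 and its triangles. *)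
have step x : \sum_(y in cnbr x) #|cnbr x :&: cnbr y|%:Z =
    1 + (deg x)%:Z * 3 + (\sum_y \sum_z triangle x y z)%:Z :> int.
  rewrite big_setU1 ?inE ?adj_irr //= setIid card_cnbr.
  have -> : \sum_(y in nbr x) #|cnbr x :&: cnbr y|%:Z =
      (deg x)%:Z * 2 + (\sum_y \sum_z triangle x y z)%:Z :> int.
    rewrite PoszSum (bigID (mem (nbr x)) predT) /=.
    rewrite [X in _ + (_ + X)]big1 ?addr0; last first.
      move=> y; rewrite inE => /negPf nxy; rewrite big1 // => z _.
      by rewrite /triangle nxy.
    rewrite [LHS](eq_bigr (fun y => 2 + (\sum_z triangle x y z)%:Z)); last first.
      by move=> y; rewrite inE => /card_cnbrI_adj ->; rewrite -!natr1; ring.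
    by rewrite big_split /= sumr_const -mulr_natl; congr (_ + _); rewrite /deg; ring.
  by rewrite intS; ring.
rewrite (eq_bigr _ (fun x _ => step x)).
by rewrite !big_split /= sum_const_int mulr1 -big_distrl /= -!PoszSum.
Qed.

Lemma coef2_ipolT : (ipol [set: G])`_2 *+ 2 = #|G|%:Z ^+ 2 - \sum_(x : G) #|cnbr x|%:Z.
Proof.
rewrite coef2_ipol (eq_bigl xpredT) => [|x]; last by rewrite inE.
rewrite (eq_bigr (fun x => #|G|%:Z - #|cnbr x|%:Z)) => [|x _]; last first.
  by have := cardsC (cnbr x); rewrite setTD; lia.
by rewrite sumrB sum_const_int -expr2.
Qed.

Lemma coef3_ipolT : (ipol [set: G])`_3 *+ 6 =
  #|G|%:Z ^+ 3 - #|G|%:Z * (\sum_(x : G) #|cnbr x|%:Z) * 3 + (\sum_(x : G) #|cnbr x|%:Z ^+ 2) * 3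
  - (#|G|%:Z + (\sum_(x : G) deg x)%:Z * 3 + num_triangles%:Z).
Proof.
set N : int := #|G|%:Z; set s1 := \sum_x _; set s2 := \sum_x _ ^+ 2.
rewrite -sum_cnbrI_cnbr.
(* By inclusion-exclusion [f x y] counts the vertices outside both closed neighbourhoods. Its sum
   over nonadjacent distinct pairs is the sum over all pairs minus the sum over [y] in [cnbr x]. *)
pose f x y : int := N - #|cnbr x|%:Z - #|cnbr y|%:Z + #|cnbr x :&: cnbr y|%:Z.
have sumN (g : int) : \sum_(x : G) g = N * g by apply: sum_const_int.
have all_f : \sum_(x : G) \sum_y f x y = N ^+ 3 - N * s1 * 2 + s2.
  rewrite /f; under eq_bigr => x _.
    rewrite big_split /= sumrB sumN sum_card_cnbrI -/s1; over.
  rewrite big_split /= sumrB sum_cnbr -big_distrr /= sumrB !sumN -/s1.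
  rewrite (eq_bigr (fun x => #|cnbr x|%:Z ^+ 2)) // -/s2; ring.
have in_f : \sum_(x : G) \sum_(y in cnbr x) f x y = N * s1 - s2 * 2 +
    \sum_(x : G) \sum_(y in cnbr x) #|cnbr x :&: cnbr y|%:Z.
  rewrite /f; under eq_bigr => x _.
    rewrite big_split /= sumrB sumr_const -mulr_natl natz mulrBr -expr2; over.
  rewrite big_split /= !sumrB sum_cnbr -big_distrl /= -/s1 -/s2.
  ring.
rewrite coef3_ipol (eq_bigl xpredT) => [|x]; last by rewrite inE.
have -> : \sum_(x : G) \sum_(y in [set: G] :\: cnbr x) #|[set: G] :\: cnbr x :\: cnbr y|%:Z =
    \sum_(x : G) \sum_y f x y - \sum_(x : G) \sum_(y in cnbr x) f x y.
  rewrite -sumrB; apply: eq_bigr => x _.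
  rewrite [X in X - _](bigID (mem (cnbr x))) /= addrAC subrr add0r.
  apply: eq_big => [y|y _]; first by rewrite in_setD in_setT andbT.
  exact: card_setC_cnbr2.
rewrite all_f in_f; ring.
Qed.

(** The second coefficient fixes the sum of the degrees, after which the third relates the sum of
    their squares to the triangles. Both sides are 12 times those of the identity with binomials. *)
Lemma degree_triangle_identity k : indep_poly G = cycle_pol k.+1 ->
  \sum_(x : G) ((deg x)%:Z - 1) * ((deg x)%:Z - 2) * 6 = num_triangles%:Z * 2 :> int.
Proof.
rewrite -ipolT => E.
have N : #|G|%:Z = (k + 4)%:R :> int.
  have := coef1_ipol [set: G].
  by rewrite E coef1_cycle cardsT => <-; congr (_%:R); lia.
have c2 := coef2_ipolT; rewrite E coef2_cycle N in c2.
have c3 := coef3_ipolT; rewrite E coef3_cycle N in c3.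
have s1 : \sum_(x : G) #|cnbr x|%:Z = (k + 4)%:R + \sum_(x : G) (deg x)%:Z.
  under eq_bigr do rewrite card_cnbr -addn1 PoszD.
  by rewrite big_split /= sum_const_int N; ring.
have s2 : \sum_(x : G) #|cnbr x|%:Z ^+ 2 =
    (k + 4)%:R + (\sum_x (deg x)%:Z) * 2 + \sum_x (deg x)%:Z ^+ 2 :> int.
  rewrite (eq_bigr (fun x => 1 + (deg x)%:Z * 2 + (deg x)%:Z ^+ 2)); last first.
    by move=> x _; rewrite card_cnbr -addn1 PoszD; ring.
  by rewrite !big_split /= sum_const_int -big_distrl /= N; ring.
rewrite (eq_bigr (fun x => ((deg x)%:Z ^+ 2 * 6 - (deg x)%:Z * 18) + 12)); last first.
  by move=> x _; ring.
rewrite big_split /= sumrB -!big_distrl /= sum_const_int N.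
rewrite PoszSum in c3; rewrite s1 s2 in c3; rewrite s1 in c2.
move: c2 c3; set S1 := \sum_x (deg x)%:Z; set S2 := \sum_x _ ^+ 2.
set K := (k + 4)%:R; have -> : k%:R = K - 4 :> int by rewrite /K; ring.
have -> : (k.+1 + 3)%:R = K by rewrite /K; congr (_%:R); lia.
have -> : k.+1%:R = K - 3 :> int by rewrite /K; ring.
(* [c2] says that there are as many edges as vertices. *)
move=> c2 c3; have ES : S1 = K * 2 by move: c2; rewrite !mulrDr; lra.
rewrite ES in c3 *; move: c3; lra.
Qed.

End Degrees.

(** * Discharging *)

Section Charge.
Variable G : sgraph.
Implicit Types (a b c v x y z : G).

Lemma triangle_swap x y z : triangle x y z = triangle y x z.
Proof. by rewrite /triangle (adj_sym x y); congr (_ && _); rewrite andbC. Qed.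

Lemma triangle_swapr x y z : triangle x y z = triangle x z y.
Proof.
rewrite /triangle (adj_sym y z).
by case: (adj x y); case: (adj z y); case: (adj x z).
Qed.

Lemma uniq_deg x s : uniq s -> {subset s <= nbr x} -> (size s <= deg x)%N.
Proof.
move=> us sub; rewrite /deg cardE; apply: uniq_leq_size => // y /sub.
by rewrite mem_enum.
Qed.

Lemma adj_neq x y : adj x y -> x != y.
Proof. by move=> xy; apply: contraTneq xy => ->; rewrite adj_irr. Qed.

Lemma triangle_deg x y z : triangle x y z -> (1 < deg x)%N.
Proof.
case/and3P=> xy yz xz; apply: (@uniq_deg x [:: y; z]).
  by rewrite /= inE adj_neq.
by move=> w; rewrite !inE => /orP[]/eqP->.
Qed.

Definition big x : bool := (2 < deg x)%N.

(* Each triangle carries charge 6 and splits it evenly among its vertices of degree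
   at least 3; a vertex receives its share twice, once for each order of the
   other two vertices. *)
Definition share x y z := (6 %/ (big x + big y + big z))%N.

Definition charge v := (\sum_y \sum_z triangle v y z * share v y z)%N.

Lemma share_swap x y z : share x y z = share y x z.
Proof. by rewrite /share (addnC (big x)). Qed.

Lemma share_swapr x y z : share x y z = share x z y.
Proof. by rewrite /share addnAC. Qed.

Hypothesis triangle_big : forall x y z, triangle x y z -> big x || big y || big z.

(** By symmetry the factor [big x] may be moved to [y] or [z]. Adding the three versions, each
    ordered triangle carries its number of big vertices times their share, which is 6 because 1, 2
    and 3 divide 6; [triangle_big] rules out division by zero. *)
Lemma sum_charge : (\sum_v big v * charge v = num_triangles G * 2)%N.
Proof.
pose F x y z := (triangle x y z * share x y z)%N.
have Fs x y z : F x y z = F y x z by rewrite /F triangle_swap share_swap.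
have Fr x y z : F x y z = F x z y by rewrite /F triangle_swapr share_swapr.
have E1 : (\sum_v big v * charge v = \sum_x \sum_y \sum_z big x * F x y z)%N.
  apply: eq_bigr => x _; rewrite big_distrr; apply: eq_bigr => y _.
  by rewrite big_distrr.
have E2 : (\sum_v big v * charge v = \sum_x \sum_y \sum_z big y * F x y z)%N.
  rewrite exchange_big E1; apply: eq_bigr => x _; apply: eq_bigr => y _.
  by apply: eq_bigr => z _; rewrite Fs.
have E3 : (\sum_v big v * charge v = \sum_x \sum_y \sum_z big z * F x y z)%N.
  rewrite E2; apply: eq_bigr => x _; rewrite exchange_big; apply: eq_bigr => y _.
  by apply: eq_bigr => z _; rewrite Fr.
suff : (\sum_v big v * charge v + \sum_v big v * charge v + \sum_v big v * charge v =
   num_triangles G * 6)%N by lia.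
rewrite {1}E1 {1}E2 {1}E3 -!big_split /= /num_triangles big_distrl /=.
apply: eq_bigr => x _; rewrite -!big_split big_distrl; apply: eq_bigr => y _.
rewrite -!big_split big_distrl; apply: eq_bigr => z _; rewrite /= /F /share.
case T: (triangle x y z); last by rewrite !mul0n !muln0.
move: (triangle_big T).
by case: (big x); case: (big y); case: (big z).
Qed.

Lemma charge_nbr v : charge v =
  (\sum_(y in nbr v) \sum_(z in nbr v) adj y z * share v y z)%N.
Proof.
rewrite [RHS]big_mkcond; apply: eq_bigr => y _; rewrite inE /triangle.
case: (adj v y); last by rewrite big1.
rewrite [RHS]big_mkcond; apply: eq_bigr => z _; rewrite inE.
by case: (adj v z); rewrite ?andbF ?andbT.
Qed.

Lemma charge_enum v s : enum (nbr v) = s ->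
  charge v = (\sum_(y <- s) \sum_(z <- s) adj y z * share v y z)%N.
Proof.
move=> <-; rewrite big_enum charge_nbr; apply: eq_bigr => y _.
by rewrite big_enum.
Qed.

(** The weights [g] split a share between [y] and [z]: the shares 6, 3, 2 are bounded by 3+3, 3+1,
    1+1. A neighbour that is not big has at most one common neighbour with [v], so it contributes at
    most 3; a big one has weight 1 and at most [(deg v).-1] common neighbours. Either way the bound
    is [(deg v).-1]. *)
Lemma charge_le_big v : (3 < deg v)%N -> (charge v <= 2 * deg v * (deg v).-1)%N.
Proof.
move=> dv; pose g y := if big y then 1%N else 3%N.
pose l y := #|nbr v :&: nbr y|.
have gl y : y \in nbr v -> (g y * l y <= (deg v).-1)%N.
  rewrite inE => vy; have lv : (l y <= (deg v).-1)%N.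
    rewrite /deg (cardsD1 y) inE vy /=; apply: subset_leq_card.
    by rewrite subsetD1 subsetIl !inE adj_irr andbF.
  have ly : (l y <= (deg y).-1)%N.
    rewrite /deg (cardsD1 v (nbr y)) inE adj_sym vy /=; apply: subset_leq_card.
    by rewrite subsetD1 subsetIr !inE adj_irr.
  rewrite /g; case: ifP; first by lia.
  by rewrite /big; lia.
have b3 : big v by rewrite /big; lia.
have sh y z : (share v y z <= g y + g z)%N.
  by rewrite /share /g b3; case: (big y); case: (big z).
have half : (\sum_(y in nbr v) \sum_(z in nbr v) adj y z * g y =
             \sum_(y in nbr v) g y * l y)%N.
  apply: eq_bigr => y _; rewrite -big_distrl /= mulnC; congr (_ * _)%N.
  rewrite /l -sum1_card [RHS]big_mkcond [LHS]big_mkcond; apply: eq_bigr => z _.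
  by rewrite !inE; case: (adj v z); case: (adj y z).
have half' : (\sum_(y in nbr v) \sum_(z in nbr v) adj y z * g z =
             \sum_(y in nbr v) g y * l y)%N.
  rewrite exchange_big -half; apply: eq_bigr => y _; apply: eq_bigr => z _.
  by rewrite adj_sym.
have le : (\sum_(y in nbr v) g y * l y <= deg v * (deg v).-1)%N.
  by rewrite -sum_nat_const; apply: leq_sum.
apply: (@leq_trans (\sum_(y in nbr v) g y * l y + \sum_(y in nbr v) g y * l y)); last lia.
rewrite charge_nbr -{1}half -half' -big_split /=; apply: leq_sum => y _.
rewrite -big_split /=; apply: leq_sum => z _; rewrite -mulnDr.
by rewrite leq_mul2l sh orbT.
Qed.

(* The neighbourhoods of a vertex of degree 3 that receives the largest possible charge. *)
Definition tight v := exists a b c, [/\ uniq [:: a; b; c],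
  forall x, adj v x = (x \in [:: a; b; c]) &
  [\/ [/\ adj a b, ~~ adj a c, ~~ adj b c, deg a = 2 & deg b = 2],
      [/\ adj a b, adj b c, ~~ adj a c, deg a = 2 & deg c = 2] |
      [/\ adj a b, adj b c & adj a c]]].

(** A neighbour lying on two triangles at [v] is itself big, so more triangles mean smaller shares:
    one, two or three triangles at [v] yield at most 2*6, 4*3 or 6*2. *)
Lemma charge_deg3 v : deg v = 3 -> (charge v <= 12)%N /\ (charge v = 12 -> tight v).
Proof.
move=> dv; have := mem_enum (nbr v); have := enum_uniq (nbr v).
have := charge_enum (erefl (enum (nbr v))); have : size (enum (nbr v)) = 3 by rewrite -cardE.
case: (enum _) => [|a [|b [|c []]]] // _ -> us mem.
have N x : adj v x = (x \in [:: a; b; c]) by rewrite mem !inE.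
have va : adj v a by rewrite N !inE eqxx.
have vb : adj v b by rewrite N !inE eqxx orbT.
have vc : adj v c by rewrite N !inE eqxx !orbT.
rewrite !big_cons !big_nil !adj_irr (adj_sym b a) (adj_sym c a) (adj_sym c b).
have gt2 x y z : adj v x -> y != z -> adj x y -> adj v y -> adj x z -> adj v z -> big x.
  move=> vx yz xy vy xz vz; apply: (@uniq_deg x [:: v; y; z]).
    by rewrite /= !inE negb_or (adj_neq vy) (adj_neq vz) yz.
  by move=> w; rewrite !inE => /or3P[]/eqP-> //; rewrite adj_sym.
have eq2 x y : adj v x -> adj x y -> adj v y -> big x = false -> deg x = 2.
  move=> vx xy vy; have : (2 <= deg x)%N.
    by apply: (@triangle_deg x y v); rewrite /triangle xy /= ![adj _ v]adj_sym vx vy.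
  by rewrite /big; lia.
have [nab nac nbc] : [/\ a != b, a != c & b != c].
  by move: us; rewrite /= !inE negb_or => /and3P[/andP[-> ->] -> _].
have ha : adj a b -> adj a c -> big a by move=> ? ?; apply: (gt2 a b c).
have hb : adj a b -> adj b c -> big b.
  by move=> ? ?; apply: (gt2 b a c); rewrite // adj_sym.
have hc : adj a c -> adj b c -> big c.
  by move=> ? ?; apply: (gt2 c a b); rewrite // adj_sym.
have bv : big v by rewrite /big dv.
have da := eq2 a; have db := eq2 b; have dc := eq2 c.
rewrite /share bv; rewrite /tight.
case eab: (adj a b) ha hb; case ebc: (adj b c) hc; case eac: (adj a c) => // hc ha hb.
- rewrite ha ?hb ?hc //; split=> // _; exists a, b, c; split=> //.
  by apply: Or33; rewrite eab ebc eac.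
- rewrite hb //; case ba: (big a); case bc: (big c); split=> // _.
  exists a, b, c; split=> //; apply: Or32; split; rewrite ?eac //.
    exact: (da b).
  by apply: (dc b); rewrite // adj_sym.
- rewrite ha //; case bb: (big b); case bc: (big c); split=> // _.
  exists b, a, c; split; first by rewrite /= !inE negb_or eq_sym nab nac nbc.
    by move=> x; rewrite N !inE orbCA.
  apply: Or32; split; rewrite ?ebc //; first by rewrite adj_sym.
    by apply: (db a); rewrite // adj_sym.
  by apply: (dc a); rewrite // adj_sym.
- case ba: (big a); case bb: (big b); split=> // _.
  exists a, b, c; split=> //; apply: Or31; split; rewrite ?eac ?ebc //.
    exact: (da b).
  by apply: (db a); rewrite // adj_sym.
- rewrite hc //; case ba: (big a); case bb: (big b); split=> // _.
  exists a, c, b; split; first by rewrite /= !inE negb_or (eq_sym c) nab nac nbc.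
    by move=> x; rewrite N !inE; congr (_ || _); rewrite orbC.
  apply: Or32; split; rewrite ?eab //; first by rewrite adj_sym.
    exact: (da c).
  exact: (db c).
- case bb: (big b); case bc: (big c); split=> // _.
  exists b, c, a; split.
  + by rewrite /= !inE negb_or (eq_sym b a) (eq_sym c a) nab nac nbc.
  + by move=> x; rewrite N !inE [RHS]orbA [RHS]orbC.
  + apply: Or31; split; rewrite // 1?adj_sym ?eab ?eac //.
      exact: (db c).
    by apply: (dc b); rewrite // adj_sym.
- case ba: (big a); case bc: (big c); split=> // _.
  exists a, c, b; split; first by rewrite /= !inE negb_or (eq_sym c) nab nac nbc.
    by move=> x; rewrite N !inE; congr (_ || _); rewrite orbC.
  apply: Or31; split; rewrite ?eab // 1?adj_sym ?ebc //.
    exact: (da c).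
  by apply: (dc a); rewrite // adj_sym.
Qed.

Hypothesis degree_identity :
  \sum_(x : G) ((deg x)%:Z - 1) * ((deg x)%:Z - 2) * 6 = (num_triangles G)%:Z * 2.

Lemma charge_tight v : (0 < deg v <= 3)%N /\ (deg v = 3 -> tight v).
Proof.
pose q x : int := ((deg x)%:Z - 1) * ((deg x)%:Z - 2) * 6.
have le x : (big x * charge x)%N%:Z <= q x /\
    ((big x * charge x)%N%:Z = q x -> (0 < deg x <= 3)%N /\ (deg x = 3 -> charge x = 12)).
  rewrite /q; case bx: (big x); move: bx; rewrite /big => bx.
    rewrite mul1n; case: (ltnP 3 (deg x)) => dx.
      have := charge_le_big dx; move: (charge x) (deg x) dx => m d dx lem.
      (* After cancelling d-1 this reads d < 3(d-2), that is, d > 3. *)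
      have : (2 * d * d.-1)%N%:Z < (d%:Z - 1) * (d%:Z - 2) * 6.
        have -> : (2 * d * d.-1)%N%:Z = 2 * d%:Z * (d%:Z - 1) by lia.
        by nia.
      by lia.
    have dx3 : deg x = 3 by lia.
    by have [] := charge_deg3 dx3; rewrite dx3; lia.
  rewrite mul0n; case: (deg x) bx => [|[|[|d]]] //.
have sum0 : \sum_(x : G) (q x - (big x * charge x)%N%:Z) = 0.
  by rewrite sumrB degree_identity -PoszSum sum_charge PoszM subrr.
have /eqP := sum0; rewrite psumr_eq0 => [/allP /(_ v)|x _]; last by rewrite subr_ge0; case: (le x).
rewrite mem_index_enum => /(_ isT) /= /eqP /subr0_eq Ev.
have [_ /(_ (esym Ev)) [-> H]] := le v; split=> // d3.
by have [_] := charge_deg3 d3; apply; apply: H.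
Qed.

End Charge.

(** * Components *)

Section InducedPaths.
Variable G : sgraph.
Implicit Types (a b c p u v w x y z : G) (A B F : {set G}) (m s t : seq G).

Fixpoint induced_path s :=
  if s is x :: t then
    [&& (if t is y :: t' then adj x y && all (fun z => ~~ adj x z) t' else true),
        x \notin t & induced_path t]
  else true.

Lemma induced_path_uniq s : induced_path s -> uniq s.
Proof. by elim: s => //= x s IH /and3P[_ -> /IH ->]. Qed.

Lemma induced_path_catl s t : induced_path (s ++ t) -> induced_path s.
Proof.
elim: s => //= x s IH /and3P[h]; rewrite mem_cat negb_or => /andP[-> _] /IH ->.
by case: s h {IH} => //= y s /andP[->]; rewrite all_cat => /andP[->].
Qed.

Lemma filter_nonadj x s : all (fun y => ~~ adj x y) s -> [seq y <- s | ~~ adj x y] = s.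
Proof. by move=> /all_filterP. Qed.

Lemma iseq_path s : induced_path s -> iseq s = path_pol (size s).
Proof.
have [n] := ubnP (size s); elim: n s => // n IH [|x [|y t]] lt_s.
- by rewrite iseq_nil.
- by move=> _; rewrite iseq_cons //= iseq_nil mulr1.
move=> /and3P[/andP[xy nadj] xs ps].
rewrite iseq_cons //= xy /= filter_nonadj // !IH //; first exact: ltnW.
by case/and3P: ps.
Qed.

Lemma induced_path_nth x0 s i j : induced_path s -> (i < size s)%N -> (j < size s)%N ->
  adj (nth x0 s i) (nth x0 s j) = (j == i.+1) || (i == j.+1).
Proof.
elim: s i j => // x s IH [|i] [|j] /and3P[h xs ps] /=; rewrite ?adj_irr // !ltnS.
- move=> _ js; case: s h js {IH xs ps} => // y s /andP[xy /allP nadj].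
  case: j => [|j] /= js; first by rewrite xy.
  by apply/negbTE/nadj; rewrite mem_nth.
- move=> is_ _; rewrite adj_sym; case: s h is_ {IH xs ps} => // y s /andP[xy /allP nadj].
  case: i => [|i] /= is_; first by rewrite xy.
  by apply/negbTE/nadj; rewrite mem_nth.
- by move=> is_ js; rewrite IH // !eqSS.
Qed.

(** Cycles and D graphs are both presented as one vertex [a] over an induced path; only the
    positions of the neighbours of [a] differ, the two ends here and the first two vertices in
    [D_shape]. Expanding at [a] leaves paths in both cases. *)
Definition cycle_shape a z m x :=
  [/\ induced_path (z :: rcons m x), a \notin z :: rcons m x, adj a z, adj a x
    & all (fun y => ~~ adj a y) m].

Lemma iseq_cycle a z m x : cycle_shape a z m x ->
  iseq (a :: z :: rcons m x) = cycle_pol (size m).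
Proof.
case=> ps aN az ax nadj; rewrite iseq_cons // iseq_path //= az filter_rcons ax /=.
rewrite filter_nonadj // size_rcons iseq_path //.
by case/and3P: ps => _ _; rewrite -cats1 => /induced_path_catl.
Qed.

Definition D_shape a y z m :=
  [/\ induced_path (y :: z :: m), a \notin y :: z :: m, adj a y, adj a z
    & all (fun w => ~~ adj a w) m].

Lemma iseq_D a y z m : D_shape a y z m ->
  iseq (a :: y :: z :: m) = cycle_pol (size m).
Proof.
case=> ps aN ay az nadj; rewrite iseq_cons // iseq_path //= ay az /=.
by rewrite filter_nonadj // iseq_path //; case/and3P: ps => _ _ /and3P[].
Qed.

(** The graph of [iseq_D] listed from its pendant end, the form in which it arises inside two
    triangles joined by a path. *)
Lemma iseq_tail_triangle a s v b : induced_path (s ++ [:: v; b]) ->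
  a \notin s ++ [:: v; b] -> adj a v -> adj a b -> all (fun y => ~~ adj a y) s ->
  iseq (a :: s ++ [:: v; b]) = cycle_pol (size s).
Proof.
move=> ps aN av ab nadj; rewrite iseq_cons // iseq_path // filter_cat /= av ab /=.
rewrite cats0 filter_nonadj // size_cat addn2 iseq_path //.
exact: induced_path_catl ps.
Qed.

Definition diamond_shape u v a c :=
  [/\ uniq [:: a; c; u; v], ~~ adj a c, [/\ adj a u, adj a v, adj c u & adj c v]
    & adj u v].

Lemma iseq_diamond u v a c : diamond_shape u v a c ->
  iseq [:: a; c; u; v] = 'X * 'X + 'X *+ 4 + 1.
Proof.
case=> us nac [au av cu cv] uv.
rewrite !iseq_cons; try by move: us => /= /and4P[].
by rewrite //= ?(au, av, cu, cv, uv, nac) /= !iseq_cons //= !iseq_nil; ring.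
Qed.

Lemma iseq_K4 a b c v : uniq [:: a; b; c; v] -> adj a b -> adj a c -> adj a v ->
  adj b c -> adj b v -> adj c v -> iseq [:: a; b; c; v] = 'X *+ 4 + 1.
Proof.
move=> us ab ac av bc bv cv; rewrite !iseq_cons; try by move: us => /= /and4P[].
by rewrite //= ?(ab, ac, av, bc, bv, cv) /= !iseq_nil; ring.
Qed.

Definition seq_closed s := forall x y, x \in s -> adj x y -> y \in s.

Lemma seq_closed_set s : seq_closed s -> closed_set [set x in s].
Proof. by move=> cs x y; rewrite !inE; apply: cs. Qed.

Lemma nbr_deg x s : uniq s -> {subset s <= nbr x} -> (deg x <= size s)%N ->
  forall y, adj x y = (y \in s).
Proof.
move=> us sub le y; have sz : (size (enum (nbr x)) <= size s)%N by rewrite -cardE.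
have sub' : {subset s <= enum (nbr x)} by move=> z /sub; rewrite mem_enum.
by have [_ ->] := uniq_min_size us sub' sz; rewrite mem_enum inE.
Qed.

(** [K4] and two triangles joined by a path are absent: [lead_bound] excludes them while a component
    is being traced. *)
Inductive component A : Prop :=
  | ComponentPath s of induced_path s & (1 < size s)%N & A = [set x in s]
  | ComponentCycle a z m x of cycle_shape a z m x & A = [set w in a :: z :: rcons m x]
  | ComponentD a y z m of D_shape a y z m & m != [::] & A = [set w in a :: y :: z :: m]
  | ComponentDiamond u v a c of diamond_shape u v a c & A = [set x in [:: a; c; u; v]].

(** * Finding a component inside a nonempty closed set *)

Hypothesis deg_bound : forall v, (0 < deg v <= 3)%N.
Hypothesis deg3_tight : forall v, deg v = 3 -> tight v.
Hypothesis lead_bound : forall A, closed_set A -> lead_coef (ipol A) <= 2.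

Variable B : {set G}.
Hypothesis closedB : closed_set B.

Definition has_component := exists A, [/\ A \subset B, A != set0, closed_set A & component A].

Lemma component_seq s : {subset s <= B} -> seq_closed s -> (0 < size s)%N ->
  component [set x in s] -> has_component.
Proof.
move=> sB cs s0 comp; exists [set x in s]; split=> //.
- by apply/subsetP=> x; rewrite inE => /sB.
- by case: s s0 {sB cs comp} => // x s _; apply/set0Pn; exists x; rewrite !inE eqxx.
- exact: seq_closed_set.
Qed.

(** The triangle [v], [a], [b] hangs on the rest of the graph at [v] only, through the edge to
    [c]. *)
Definition apex v a b c :=
  [/\ uniq [:: a; b; c], forall x, adj v x = (x \in [:: a; b; c]),
      forall x, adj a x = (x \in [:: v; b]) & forall x, adj b x = (x \in [:: v; a])].

(** The first tight neighbourhood is an apex. In the other two the degree bounds leave no further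
    edges, so the four vertices are closed: a [K4 - e], or a [K4], whose leading coefficient 4 is
    too large. *)
Lemma deg3_apex v : v \in B -> deg v = 3 -> has_component \/ exists a b c, apex v a b c.
Proof.
move=> vB /deg3_tight [a [b [c [us Nv T]]]].
have [nab nac nbc] : [/\ a != b, a != c & b != c].
  by move: us; rewrite /= !inE negb_or => /and3P[/andP[-> ->] -> _].
have va : adj v a by rewrite Nv !inE eqxx.
have vb : adj v b by rewrite Nv !inE eqxx orbT.
have vc : adj v c by rewrite Nv !inE eqxx !orbT.
have [va' vb' vc'] : [/\ a != v, b != v & c != v].
  by split; apply: adj_neq; rewrite adj_sym.
have [aB bB cB] : [/\ a \in B, b \in B & c \in B] by split; apply: closedB vB _.
have le3 x : (deg x <= 3)%N by case/andP: (deg_bound x).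
have sub3 x y z w : adj x y -> adj x z -> adj x w -> {subset [:: y; z; w] <= nbr x}.
  by move=> xy xz xw t; rewrite !inE => /or3P[] /eqP->.
have sub2 x y z : adj x y -> adj x z -> {subset [:: y; z] <= nbr x}.
  by move=> xy xz t; rewrite !inE => /orP[] /eqP->.
case: T => [[ab nac' nbc' da db]|[ab bc nac' da dc]|[ab bc ac]].
- right; exists a, b, c; split=> // x.
    apply: nbr_deg; rewrite ?da // /=; first by rewrite inE eq_sym vb'.
    by apply: sub2; rewrite // adj_sym.
  apply: nbr_deg; rewrite ?db // /=; first by rewrite inE eq_sym va'.
  by apply: sub2; rewrite // adj_sym.
- left; apply: (@component_seq [:: a; c; v; b]) => //.
  + by move=> x; rewrite !inE => /or4P[] /eqP->.
  + have Na : forall x, adj a x = (x \in [:: v; b]).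
      apply: nbr_deg; rewrite ?da // /=; first by rewrite inE eq_sym vb'.
      by apply: sub2; rewrite // adj_sym.
    have Nc : forall x, adj c x = (x \in [:: v; b]).
      apply: nbr_deg; rewrite ?dc // /=; first by rewrite inE eq_sym vb'.
      by apply: sub2; rewrite // adj_sym.
    have Nb : forall x, adj b x = (x \in [:: a; c; v]).
      apply: nbr_deg => //; first by rewrite /= !inE negb_or nac va' vc'.
      by apply: sub3; rewrite // adj_sym.
    move=> x y; rewrite !inE => /or4P[] /eqP->; rewrite ?Na ?Nc ?Nb ?Nv !inE.
    * by case/orP=> /eqP->; rewrite eqxx ?orbT.
    * by case/orP=> /eqP->; rewrite eqxx ?orbT.
    * by case/or3P=> /eqP->; rewrite eqxx ?orbT.
    * by case/or3P=> /eqP->; rewrite eqxx ?orbT.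
  + apply: (@ComponentDiamond _ v b a c) => //; split=> //.
      by rewrite /= !inE !negb_or nac va' nab vc' (eq_sym c b) nbc (eq_sym v b) vb'.
    by split; rewrite // adj_sym.
- have Nx x y z w : uniq [:: y; z; w] -> adj x y -> adj x z -> adj x w ->
      forall t : G, adj x t = (t \in [:: y; z; w]).
    by move=> uw xy xz xw; apply: nbr_deg => //; apply: sub3.
  have : seq_closed [:: a; b; c; v].
    have Na := @Nx a b c v; have Nb := @Nx b a c v; have Nc := @Nx c a b v.
    rewrite /= !inE !negb_or nbc vb' vc' in Na; rewrite /= !inE !negb_or nac va' vc' in Nb.
    rewrite /= !inE !negb_or nab va' vb' in Nc.
    move=> x y; rewrite !inE => /or4P[] /eqP->.
    * rewrite Na //; last by rewrite adj_sym.
      by rewrite !inE => /or3P[] /eqP->; rewrite eqxx ?orbT.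
    * rewrite Nb //; try by rewrite adj_sym.
      by rewrite !inE => /or3P[] /eqP->; rewrite eqxx ?orbT.
    * rewrite Nc //; try by rewrite adj_sym.
      by rewrite !inE => /or3P[] /eqP->; rewrite eqxx ?orbT.
    * by rewrite Nv !inE => /or3P[] /eqP->; rewrite eqxx ?orbT.
  move=> /seq_closed_set /lead_bound; rewrite -/(iseq _) iseq_K4 //; try by rewrite adj_sym.
    by have [_ ->] := @deg_lead_linear 4 isT.
  by rewrite /= !inE !negb_or nab nac va' nbc vb' vc'.
Qed.

(* Walks are extended at the head of the list. *)
Definition walk F s :=
  [/\ induced_path s, {subset s <= B}, forall x, x \in s -> x \notin F
    & forall x y, x \in behead s -> adj x y -> (y \in F) || (y \in s)].

(** [F] holds a vertex set aside, such as one at which a cycle is opened or a vertex of a triangle,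
    so that the walk remains an induced path although it closes up through [F]. *)
Definition exits F s z := [set y in nbr z | (y \notin F) && (y \notin s)].

Lemma walk_max F z t : walk F (z :: t) -> exists (w : seq G) z' t',
  [/\ z' :: t' = w ++ z :: t, walk F (z' :: t') & #|exits F (z' :: t') z'| != 1%N].
Proof.
have [n] := ubnP (#|G| - size t); elim: n z t => // n IH z t le_n W.
case: (eqVneq #|exits F (z :: t) z| 1%N) => [/eqP /cards1P [y Ey]|ne]; last first.
  by exists [::], z, t.
have : y \in exits F (z :: t) z by rewrite Ey inE.
rewrite !inE negb_or => /and3P[zy yF /andP[yz yt]].
case: W => ps sB sF N; have yzt : y \notin z :: t by rewrite inE negb_or yz.
have W' : walk F (y :: z :: t).
  split.
  - rewrite /= -/(induced_path (z :: t)) ps andbT adj_sym zy yzt andbT /=.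
    (* A chord back to an earlier vertex is impossible: the neighbours of such a vertex already lie
       in [F] or on the walk, and [y] does not. *)
    apply/allP=> x xt; apply: contraNN yzt => yx.
    have := N x y xt; rewrite adj_sym yx => /(_ isT); by rewrite (negPf yF).
  - by move=> x; rewrite inE => /orP[/eqP->|/sB //]; apply: closedB zy; apply: sB; rewrite inE eqxx.
  - by move=> x; rewrite inE => /orP[/eqP->|/sF].
  - move=> x w /=; rewrite inE => /orP[/eqP-> zw|xt xw]; last first.
      by have /orP[->//|wzt] := N x w xt xw; rewrite inE wzt !orbT.
    case wF: (w \in F) => //=; rewrite inE; case wzt: (w \in z :: t); rewrite ?orbT ?orbF //.
    have : w \in exits F (z :: t) z by rewrite inE [w \in nbr z]inE zw wF wzt.
    by rewrite Ey inE => ->.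
have lt_n : (#|G| - size (z :: t) < n)%N.
  have /card_uniqP sz := induced_path_uniq (let: And4 p _ _ _ := W' in p).
  have : (size (y :: z :: t) <= #|G|)%N by rewrite -sz max_card.
  by move: le_n => /=; move: (size t) #|G| => k N'; lia.
have [w [z' [t' [E W'' ne]]]] := IH y (z :: t) lt_n W'.
by exists (w ++ [:: y]), z', t'; split=> //; rewrite E -catA.
Qed.

Lemma walk_closed F z t : walk F (z :: t) -> #|exits F (z :: t) z| = 0 ->
  forall x y, x \in z :: t -> adj x y -> (y \in F) || (y \in z :: t).
Proof.
case=> _ _ _ N /eqP; rewrite cards_eq0 => /eqP E x y.
rewrite inE => /orP[/eqP-> zy|]; last exact: N.
have : y \notin exits F (z :: t) z by rewrite E inE.
by rewrite inE [y \in nbr z]inE zy /= negb_and !negbK.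
Qed.

Lemma exits_behead F z p t : walk F (z :: p :: t) ->
  [/\ adj z p, p \notin exits F (z :: p :: t) z
    & (#|exits F (z :: p :: t) z| < deg z)%N].
Proof.
case=> /and3P[/andP[zp _] _ _] _ _ _.
have pE : p \notin exits F (z :: p :: t) z by rewrite !inE eqxx orbT /= !andbF.
split=> //; apply: proper_card; apply/properP; split.
  by apply/subsetP=> y; rewrite inE => /andP[].
by exists p => //; rewrite inE.
Qed.

(** Two exits besides the predecessor [p] force degree 3. If [p] were one of the degree-2 vertices
    of the triangle at [z], the other one would be a neighbour of [p] outside [F] and the walk. *)
Lemma walk_end_triangle F z p t : walk F (z :: p :: t) ->
  (1 < #|exits F (z :: p :: t) z|)%N ->
  has_component \/ exists a b, [/\ apex z a b p, a \notin F, b \notin F,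
    a \notin z :: p :: t & b \notin z :: p :: t].
Proof.
move=> W gt1; have [zp pE ltd] := exits_behead W.
have /andP[_ le3] := deg_bound z.
have d3 : deg z = 3 by lia.
have zB : z \in B by case: W => _ sB _ _; apply: sB; rewrite inE eqxx.
case: (deg3_apex zB d3) => [|[a [b [c [us Nz Na Nb]]]]]; first by left.
have card2 : #|exits F (z :: p :: t) z| = 2 by lia.
have exitE y : y \in nbr z -> y != p -> y \in exits F (z :: p :: t) z.
  have -> : exits F (z :: p :: t) z = nbr z :\ p.
    apply/eqP; rewrite eqEcard; apply/andP; split.
      rewrite subsetD1 pE andbT; apply/subsetP=> x; rewrite inE => /andP[] //.
    by move: d3; rewrite card2 /deg (cardsD1 p) inE zp; lia.
  by rewrite !inE => -> ->.
have nbrB q y : p = q -> adj z y -> y != p -> adj q y -> False.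
  move=> <- zy yp py; have := exitE y; rewrite !inE zy => /(_ isT yp).
  case: W => _ _ _ /(_ p y); rewrite inE eqxx py => /(_ isT isT).
  by rewrite !inE => /orP[->|/orP[->|->]]; rewrite ?andbF ?orbT ?andbF.
have [nab nac nbc] : [/\ a != b, a != c & b != c].
  by move: us; rewrite /= !inE negb_or => /and3P[/andP[-> ->] -> _].
have za : adj z a by rewrite Nz !inE eqxx.
have zb : adj z b by rewrite Nz !inE eqxx orbT.
have : p \in [:: a; b; c] by rewrite -Nz.
rewrite !inE => /or3P[] /eqP Ep.
- case: (nbrB a b) => //; first by rewrite Ep eq_sym.
  by rewrite Na !inE eqxx orbT.
- case: (nbrB b a) => //; first by rewrite Ep.
  by rewrite Nb !inE eqxx orbT.
right; exists a, b; rewrite Ep.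
have /[!inE] /and3P[_ aF aS] : a \in exits F (z :: p :: t) z by rewrite exitE ?inE ?Ep.
have /[!inE] /and3P[_ bF bS] : b \in exits F (z :: p :: t) z by rewrite exitE ?inE ?Ep.
by rewrite -Ep; split=> //; rewrite Ep.
Qed.

(** A walk started at a leaf stops either without exits, giving a path, or at the apex of a
    triangle, giving a D graph. *)
Lemma leaf_component x : x \in B -> deg x = 1 -> has_component.
Proof.
move=> xB dx; have W0 : walk set0 [:: x].
  by split=> // y; rewrite ?inE // => /eqP->.
have [w [z [t [E W ne]]]] := walk_max W0.
have [ps sB _ N] := W.
case: (posnP #|exits set0 (z :: t) z|) => [e0|e_gt0].
  have cs : seq_closed (z :: t).
    by move=> y u yS yu; have := walk_closed W e0 yS yu; rewrite inE.
  apply: (component_seq sB cs) => //; apply: (@ComponentPath _ (z :: t)) => //.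
  case: t {E ps sB N W ne e0} cs => // cs.
  have /andP[/card_gt0P [y]] := deg_bound z; rewrite inE => zy.
  by have := cs z y; rewrite !inE eqxx => /(_ isT zy) /eqP yz; rewrite yz adj_irr in zy.
have e_gt1 : (1 < #|exits set0 (z :: t) z|)%N by lia.
case: t E W N ps sB {ne e_gt0} e_gt1 => [|p t] E W N ps sB e_gt1.
  have zx : z = x by case: w E => [[]//|y [|? ?] [] //].
  have : (#|exits set0 [:: z] z| <= deg z)%N.
    by apply: subset_leq_card; apply/subsetP=> y; rewrite inE => /andP[].
  by rewrite zx dx leqNgt -zx e_gt1.
case: (walk_end_triangle W e_gt1) => // [[a [b [[us Nz Na Nb] _ _ aS bS]]]].
have zS : z \notin p :: t by case/and3P: ps.
have nadj (c d : G) (u : seq G) : (forall x, adj c x = (x \in [:: z; d])) ->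
    z \notin u -> d \notin u -> all (fun y => ~~ adj c y) u.
  move=> Nc zu du; apply/allP=> y yu; rewrite Nc !inE negb_or.
  by apply/andP; split; apply: contraTneq yu => ->.
have [aN bN] : a \notin p :: t /\ b \notin p :: t.
  by split; [apply: contra aS|apply: contra bS]; rewrite !inE => ->; rewrite orbT.
have nab : a != b by move: us; rewrite /= !inE negb_or => /andP[/andP[]].
apply: (@component_seq [:: a, b, z, p & t]) => //.
- have zB : z \in B by apply: sB; rewrite inE eqxx.
  have [za zb] : adj z a /\ adj z b by rewrite !Nz !inE !eqxx !orbT.
  move=> y; rewrite 2!inE => /or3P[/eqP->|/eqP->|/sB //]; exact: closedB zB _.
- move=> y u; rewrite 3!inE => /or4P[/eqP->|/eqP->|/eqP->|yt yu].
  + by rewrite Na !inE => /orP[]/eqP->; rewrite eqxx ?orbT.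
  + by rewrite Nb !inE => /orP[]/eqP->; rewrite eqxx ?orbT.
  + by rewrite Nz !inE => /or3P[]/eqP->; rewrite eqxx ?orbT.
  + have /orP[|uS] := N y u yt yu; first by rewrite inE.
    by rewrite 2!inE uS !orbT.
- apply: (@ComponentD _ a b z (p :: t)) => //; split.
  + rewrite /= -/(induced_path [:: z, p & t]) ps bS !andbT Nb !inE eqxx /=.
    exact: (nadj b a (p :: t)).
  + by rewrite inE negb_or nab.
  + by rewrite Na !inE eqxx orbT.
  + by rewrite Na !inE eqxx.
  + exact: (nadj a b).
Qed.

(** Leaving the triangle through [c], the walk meets no leaf and cannot return to itself, so it ends
    at a second triangle, and the leading coefficient forbids this. The conclusion is reached only
    when [walk_end_triangle] itself delivers a component. *)
Lemma apex_component v a b c : {in B, forall x, deg x != 1%N} -> v \in B -> apex v a b c ->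
  has_component.
Proof.
move=> no_leaf vB [us Nv Na Nb].
have [nab nac nbc] : [/\ a != b, a != c & b != c].
  by move: us; rewrite /= !inE negb_or => /and3P[/andP[-> ->] -> _].
have va : adj v a by rewrite Nv !inE eqxx.
have vb : adj v b by rewrite Nv !inE eqxx orbT.
have vc : adj v c by rewrite Nv !inE eqxx !orbT.
have [aB bB] : a \in B /\ b \in B by split; apply: closedB vB _.
(* With [a] in [F], the vertex [b] has no neighbour left and the walk can grow only from [v]. *)
have W0 : walk [set a] [:: v; b].
  split.
  - by rewrite /= vb inE adj_neq.
  - by move=> x; rewrite !inE => /orP[]/eqP->.
  - by move=> x; rewrite !inE => /orP[]/eqP->; [exact: adj_neq|rewrite eq_sym].
  - by move=> x y /=; rewrite mem_seq1 => /eqP->; rewrite Nb !inE => /orP[]->; rewrite ?orbT.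
have [w [z [t [E W ne]]]] := walk_max W0.
have [ps sB sF N] := W; have us' := induced_path_uniq ps.
have aS : a \notin z :: t by apply/negP=> /sF; rewrite inE eqxx.
case: w E => [|w0 w] [] Ez Et.
  have cE : exits [set a] (z :: t) z = [set c].
    apply/setP=> x; rewrite Ez Et !inE Nv !inE.
    case: (eqVneq x a) => [->|_]; first by rewrite andbF (negPf nac).
    case: (eqVneq x b) => [->|_]; first by rewrite orbT !andbF (negPf nbc).
    case: (eqVneq x c) => [->|_] //=.
    by rewrite orbF eq_sym adj_neq.
  by rewrite cE cards1 in ne.
case: t Et W N ps sB sF us' aS ne => [|p t] Et W N ps sB sF us' aS ne; first by case: w Et.
have vS : v \in p :: t by rewrite Et mem_cat inE eqxx orbT.
have bS : b \in p :: t by rewrite Et mem_cat !inE eqxx !orbT.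
have zS : z \notin p :: t by case/andP: us'.
have [zv zb] : z != v /\ z != b by split; apply: contraNneq zS => ->.
case: (posnP #|exits [set a] (z :: p :: t) z|) => [e0|e_gt0].
  have zB : z \in B by apply: sB; rewrite inE eqxx.
  have : (1 < deg z)%N by have /andP[d0 _] := deg_bound z; rewrite ltn_neqAle eq_sym no_leaf.
  have [zp _ _] := exits_behead W.
  rewrite /deg (cardsD1 p) inE zp add1n ltnS => /card_gt0P [y]; rewrite !inE => /andP[yp zy].
  have := walk_closed W e0 (mem_head _ _) zy; rewrite inE => /orP[/eqP ya|].
    by move: zy; rewrite ya adj_sym Na !inE (negPf zv) (negPf zb).
  rewrite !inE (negPf yp) /= => /orP[/eqP yz|yt]; first by rewrite yz adj_irr in zy.
  by case/and3P: ps => /andP[_ /allP /(_ y yt)]; rewrite zy.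
have e_gt1 : (1 < #|exits [set a] (z :: p :: t) z|)%N by rewrite ltn_neqAle eq_sym ne.
case: (walk_end_triangle W e_gt1) => // [[y1 [y2 [[us2 Nz N1 N2] y1F y2F y1S y2S]]]].
rewrite !inE in y1F y2F.
have n12 : y1 != y2 by move: us2; rewrite /= !inE negb_or => /andP[/andP[]].
have nadjL (c1 d : G) (u : seq G) : (forall x, adj c1 x = (x \in [:: z; d])) ->
    z \notin u -> d \notin u -> all (fun y => ~~ adj c1 y) u.
  move=> Nc zu du; apply/allP=> y yu; rewrite Nc !inE negb_or.
  by apply/andP; split; apply: contraTneq yu => ->.
have aP : a \notin p :: t by apply: contra aS; apply: (@mem_behead _ (z :: p :: t)).
have y1P : y1 \notin p :: t by apply: contra y1S; exact: (@mem_behead _ (z :: p :: t)).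
have y2P : y2 \notin p :: t by apply: contra y2S; exact: (@mem_behead _ (z :: p :: t)).
have az : a != z by move: aS; rewrite inE negb_or => /andP[].
have nav : a != v by rewrite adj_neq // Na !inE eqxx.
have ps2 : induced_path (y2 :: z :: p :: t).
  rewrite /= -/(induced_path [:: z, p & t]) ps y2S !andbT N2 !inE eqxx /=.
  exact: (nadjL y2 y1 (p :: t)).
have closedS : closed_set [set x in [:: y1, a, y2, z, p & t]].
  apply: seq_closed_set => x y; rewrite 4!inE.
  case/or4P=> [/eqP->|/eqP->|/eqP->|].
  - by rewrite N1 !inE => /orP[]/eqP->; rewrite eqxx ?orbT.
  - rewrite Na !inE => /orP[]/eqP->.
      by move: vS; rewrite inE => ->; rewrite !orbT.
    by move: bS; rewrite inE => ->; rewrite !orbT.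
  - by rewrite N2 !inE => /orP[]/eqP->; rewrite eqxx ?orbT.
  case/orP=> [/eqP->|xt xy].
    by rewrite Nz !inE => /or3P[]/eqP->; rewrite eqxx ?orbT.
  have /orP[|yS] := N x y xt xy; first by rewrite inE => /eqP->; rewrite !inE eqxx orbT.
  by rewrite 3!inE yS !orbT.
(* [w] is the part of the walk strictly between [z] and [v]. Expanding at [y1] leaves two D graphs
   that both end in the triangle [a], [v], [b]. *)
have := lead_bound closedS; rewrite -/(iseq _) iseq_cons; last first.
  by rewrite !inE negb_or y1F negb_or n12.
have -> : [seq y <- [:: a, y2, z, p & t] | ~~ adj y1 y] = a :: p :: t.
  have y1a : adj y1 a = false by rewrite N1 !inE (negPf az) eq_sym (negPf y2F).
  have [y12 y1z] : adj y1 y2 /\ adj y1 z by rewrite !N1 !inE !eqxx orbT.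
  rewrite [filter _ _]/= y1a y12 y1z [in RHS](_ : p :: t = [seq y <- p :: t | ~~ adj y1 y]) //.
  by rewrite filter_nonadj //; apply: (nadjL y1 y2).
have a_av : adj a v by rewrite Na !inE eqxx.
have a_ab : adj a b by rewrite Na !inE eqxx orbT.
have uw : uniq (w ++ [:: v; b]) by rewrite -Et; case/andP: us'.
have nadjw : all (fun y => ~~ adj a y) w.
  apply/allP=> y yw; rewrite Na !inE negb_or; move: uw; rewrite cat_uniq.
  case/and3P=> _ /hasPn h _; apply/andP; split; apply: contraTneq yw => ->; apply: h;
  by rewrite !inE eqxx ?orbT.
have -> : iseq (a :: p :: t) = cycle_pol (size w).
  rewrite Et; apply: iseq_tail_triangle; rewrite // -Et //.
  by case/and3P: ps.
have -> : iseq [:: a, y2, z, p & t] = cycle_pol (size w).+2.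
  rewrite Et; apply: (@iseq_tail_triangle a [:: y2, z & w]) => //=.
  - by rewrite -Et.
  - by rewrite -Et inE negb_or eq_sym y2F.
  - rewrite !Na !inE !negb_or zv zb nadjw !andbT.
    by apply/andP; split; apply: contraNneq y2P => ->.
by have [d [l [[_ ->] l_gt2]]] := deg_lead_dumbbell (size w); rewrite ler_nat leqNgt l_gt2.
Qed.

(** The cycle is opened at [a]: a walk from [x] that avoids [a] can stop only at a neighbour of [a],
    which must be [y]. *)
Lemma two_regular_component a : {in B, forall x, deg x = 2} -> a \in B -> has_component.
Proof.
move=> d2 aB; have /eqP/cards2P [x [y [nxy Ea]]] := d2 a aB.
have Na u : adj a u = (u == x) || (u == y) by move/setP: Ea => /(_ u); rewrite !inE.
have ax : adj a x by rewrite Na eqxx.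
have ay : adj a y by rewrite Na eqxx orbT.
have W0 : walk [set a] [:: x].
  split=> //.
    by move=> u; rewrite inE => /eqP->; apply: closedB ax.
  by move=> u; rewrite !inE => /eqP->; rewrite eq_sym adj_neq.
have [w [z [t [E W ne]]]] := walk_max W0.
have [ps sB sF N] := W; have us := induced_path_uniq ps.
have aS : a \notin z :: t by apply/negP=> /sF; rewrite inE eqxx.
have zB : z \in B by apply: sB; rewrite inE eqxx.
case: t E W N ps sB sF us aS ne => [|p t] E W N ps sB sF us aS ne.
  have zx : z = x by case: w E => [[]//|? [|? ?] [] //].
  have dz := d2 z zB; case/eqP: ne.
  have -> : exits [set a] [:: z] z = nbr z :\ a.
    apply/setP=> u; rewrite !inE; case: (eqVneq u z) => [->|_]; last by rewrite andbT andbC.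
    by rewrite adj_irr !andbF.
  by move: dz; rewrite zx /deg (cardsD1 a) inE adj_sym ax => -[].
have [zp _ lt2] := exits_behead W; rewrite d2 // in lt2.
have e0 : #|exits [set a] (z :: p :: t) z| = 0.
  by move: lt2 ne; case: #|_| => [|[|?]].
have zy : z = y /\ adj a z.
  have := d2 z zB; rewrite /deg (cardsD1 p) inE zp add1n => -[] /eqP /cards1P [q Eq].
  have := set11 q; rewrite -Eq !inE => /andP[qp zq].
  have := walk_closed W e0 (mem_head _ _) zq; rewrite inE => /orP[/eqP qa|].
    have az : adj a z by rewrite -qa adj_sym.
    split=> //; move: (az); rewrite Na => /orP[/eqP zx|/eqP//].
    case: w E => [[]//|w0 w [_ Et]].
    by case/andP: us; rewrite Et mem_cat inE zx eqxx orbT.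
  rewrite !inE (negPf qp) /= => /orP[/eqP qz|qt]; first by rewrite qz adj_irr in zq.
  by case/and3P: ps => /andP[_ /allP /(_ q qt)]; rewrite zq.
case: zy => zy az; case: w E => [[]//|w0 w [_ Et]].
have Es : z :: p :: t = z :: rcons w x by rewrite Et cats1.
rewrite Es in W N ps sB sF us aS e0.
have cs : seq_closed (a :: z :: rcons w x).
  move=> u v; rewrite inE => /orP[/eqP->|uS uv].
    by rewrite Na -zy !inE mem_rcons inE => /orP[]->; rewrite ?orbT.
  by have := walk_closed W e0 uS uv; rewrite inE [_ \in a :: _]inE.
apply: (component_seq _ cs) => //.
  by move=> u; rewrite inE => /orP[/eqP->|/sB].
apply: (@ComponentCycle _ a z w x) => //; split=> //.
apply/allP=> u uw; rewrite Na negb_or; move: us => /= /andP[zN].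
rewrite rcons_uniq => /andP[xw _]; rewrite -zy; apply/andP; split.
  by apply: contraNneq xw => <-.
by apply: contraNneq zN => <-; rewrite mem_rcons inE uw orbT.
Qed.

Lemma exists_component x : x \in B -> has_component.
Proof.
move=> xB; case: (boolP [exists v in B, deg v == 1%N]) => [/exists_inP[v vB /eqP]|no_leaf].
  exact: leaf_component.
have leafB : {in B, forall v, deg v != 1%N}.
  by move=> v vB; apply: contra no_leaf => dv; apply/exists_inP; exists v.
case: (boolP [exists v in B, deg v == 3%N]) => [/exists_inP[v vB /eqP dv]|no3].
  have [//|[a [b [c apx]]]] := deg3_apex vB dv.
  exact: apex_component leafB vB apx.
apply: two_regular_component xB => v vB.
have /andP[] := deg_bound v; have := leafB v vB.
have : deg v != 3%N by apply: contra no3 => dv; apply/exists_inP; exists v.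
by case: (deg v) => [|[|[|[|?]]]].
Qed.

End InducedPaths.

(** * Isomorphisms *)

Section Isomorphism.
Variables G H : sgraph.

Lemma ipol_imset (f : G -> H) : bijective f -> (forall x y, adj (f x) (f y) = adj x y) ->
  forall A : {set G}, ipol (f @: A) = ipol A.
Proof.
move=> /bij_inj injf adjf; elim/ipol_ind => [|x A xA IH1 IH2].
  by rewrite imset0 !ipol0.
rewrite (ipol_rec xA) (@ipol_rec _ (f x)) ?imset_f // -IH1 -IH2.
have -> : [set f y | y in A :\ x] = [set f y | y in A] :\ f x.
  apply/esym/setP=> y; apply/setD1P/imsetP => [[yx /imsetP[z zA Ey]]|[z /setD1P[zx zA] ->]].
    by exists z => //; rewrite !inE zA andbT; apply: contra yx => /eqP<-; rewrite Ey.
  by rewrite (inj_eq injf) imset_f.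
suff -> : [set f y | y in A :\: cnbr x] = [set f y | y in A] :\: cnbr (f x) by [].
apply/esym/setP=> y; apply/setDP/imsetP => [[/imsetP[z zA ->]]|[z /setDP[zA zx] ->]].
  by rewrite in_cnbr (inj_eq injf) adjf => nz; exists z; rewrite // inE in_cnbr nz.
by rewrite imset_f // in_cnbr (inj_eq injf) adjf -in_cnbr.
Qed.

Lemma iso_indep_poly : iso G H -> indep_poly G = indep_poly H.
Proof.
move=> [f [bf adjf]]; rewrite -!ipolT -(ipol_imset bf adjf); congr ipol.
case: bf => g fK gK; apply/setP=> y; rewrite inE.
by apply/imsetP; exists (g y); rewrite ?gK.
Qed.

Lemma iso_of_seqs (x0 : G) (y0 : H) (s : seq G) (t : seq H) :
  uniq s -> uniq t -> size s = size t -> (forall x, x \in s) -> (forall y, y \in t) ->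
  (forall i j, (i < size s)%N -> (j < size s)%N ->
     adj (nth x0 s i) (nth x0 s j) = adj (nth y0 t i) (nth y0 t j)) -> iso G H.
Proof.
move=> us ut st sT tT adjE; exists (fun x => nth y0 t (index x s)); split.
  exists (fun y => nth x0 s (index y t)) => [x|y].
    by rewrite index_uniq ?nth_index // -st index_mem.
  by rewrite index_uniq ?nth_index // st index_mem.
by move=> x y; rewrite -adjE ?index_mem // !nth_index.
Qed.

(** A vertex over an induced path is determined up to isomorphism by the positions of its neighbours
    on the path, which treats cycles and D graphs together. *)
Lemma iso_cone (a : G) (b : H) (s : seq G) (t : seq H) :
  induced_path s -> induced_path t -> a \notin s -> b \notin t -> size s = size t ->
  (forall x, x \in a :: s) -> (forall y, y \in b :: t) ->
  (forall i, (i < size s)%N -> adj a (nth a s i) = adj b (nth b t i)) -> iso G H.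
Proof.
move=> ps pt aN bN st sT tT adjE; apply: (@iso_of_seqs a b (a :: s) (b :: t)) => //.
- by rewrite /= aN induced_path_uniq.
- by rewrite /= bN induced_path_uniq.
- by rewrite /= st.
case=> [|i] [|j] /=; rewrite ?adj_irr // !ltnS => is_ js.
- exact: adjE.
- by rewrite adj_sym [RHS]adj_sym adjE.
- by rewrite !induced_path_nth // -?st.
Qed.

End Isomorphism.

Lemma adj_cycle_nth (G : sgraph) (a z x : G) m i : cycle_shape a z m x ->
  (i < (size m).+2)%N ->
  adj a (nth a (z :: rcons m x) i) = (i == 0)%N || (i == (size m).+1).
Proof.
case=> _ _ az ax /allP nadj; case: i => [|i] /= lt_i; first by rewrite az.
rewrite nth_rcons eqSS; case: ltngtP => [im|mi|_].
- by apply/negbTE/nadj; rewrite mem_nth.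
- by move: lt_i; rewrite !ltnS leqNgt mi.
- by rewrite ax.
Qed.

Lemma adj_D_nth (G : sgraph) (a y z : G) m i : D_shape a y z m ->
  (i < (size m).+2)%N -> adj a (nth a (y :: z :: m) i) = (i < 2)%N.
Proof.
case=> _ _ ay az /allP nadj; case: i => [|[|i]] //= lt_i.
by apply/negbTE/nadj; rewrite mem_nth.
Qed.

Lemma iso_cycle_shape (G H : sgraph) (a z x : G) m (a' z' x' : H) m' :
  cycle_shape a z m x -> cycle_shape a' z' m' x' -> size m = size m' ->
  (forall w, w \in a :: z :: rcons m x) -> (forall w, w \in a' :: z' :: rcons m' x') ->
  iso G H.
Proof.
move=> c c' sm sT sT'; have [ps aN _ _ _] := c; have [ps' aN' _ _ _] := c'.
apply: iso_cone ps ps' aN aN' _ sT sT' _; first by rewrite /= !size_rcons sm.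
rewrite /= size_rcons => i lt_i.
by rewrite (adj_cycle_nth c) // (adj_cycle_nth c') -?sm.
Qed.

Lemma iso_D_shape (G H : sgraph) (a y z : G) m (a' y' z' : H) m' :
  D_shape a y z m -> D_shape a' y' z' m' -> size m = size m' ->
  (forall w, w \in a :: y :: z :: m) -> (forall w, w \in a' :: y' :: z' :: m') ->
  iso G H.
Proof.
move=> c c' sm sT sT'; have [ps aN _ _ _] := c; have [ps' aN' _ _ _] := c'.
apply: iso_cone ps ps' aN aN' _ sT sT' _; first by rewrite /= sm.
by move=> i lt_i; rewrite (adj_D_nth c) // (adj_D_nth c') -?sm.
Qed.

(** * Shapes of the standard cycles and D graphs *)

Lemma induced_path_iota (G : sgraph) (f : nat -> G) b n :
  (forall i j, (b <= i)%N -> (i < j)%N -> (j < b + n)%N ->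
     f i != f j /\ adj (f i) (f j) = (j == i.+1)) ->
  induced_path [seq f i | i <- iota b n].
Proof.
elim: n b => //= n IH b h; rewrite -/(induced_path _) IH; last first.
  by move=> i j bi ij jn; apply: h; lia.
rewrite andbT; apply/andP; split.
  case: n {IH} h => //= n h.
  have [_ ->] : f b != f b.+1 /\ adj (f b) (f b.+1) = (b.+1 == b.+1) by apply: h; lia.
  rewrite eqxx /=; apply/allP=> _ /mapP[i /[!mem_iota] lt_i ->].
  have [_ ->] : f b != f i /\ adj (f b) (f i) = (i == b.+1) by apply: h; lia.
  by lia.
apply/mapP=> -[i /[!mem_iota] lt_i E].
have [] : f b != f i /\ adj (f b) (f i) = (i == b.+1) by apply: h; lia.
by rewrite E eqxx.
Qed.

Lemma inord_cover k (w : 'I_k.+1) : w \in inord 0 :: [seq inord i | i <- iota 1 k].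
Proof.
case: (posnP w) => w0; first by rewrite inE -val_eqE /= inordK // w0.
rewrite inE; apply/orP; right; apply/mapP; exists (w : nat); last by rewrite inord_val.
by rewrite mem_iota w0 /= add1n ltn_ord.
Qed.

Lemma adj_cycle_graph k i j : (i < j < k.+3)%N ->
  @adj (cycle_graph k.+3) (inord i) (inord j) = (j == i.+1) || (i == 0)%N && (j == k.+2).
Proof.
move=> /andP[ij jk]; rewrite /= /rel_adj -val_eqE /= !inordK //; last exact: ltn_trans jk.
(* As [i < j], only the successor of [j] can wrap around, and only for [j = k.+2]. *)
rewrite (modn_small (_ : i.+1 < k.+3)%N); last by lia.
case: (ltngtP j k.+2) => jk2; last 1 first.
- by rewrite jk2 modnn; lia.
- by rewrite modn_small; lia.
- by lia.
Qed.

Lemma adj_D_graph k i j : (i < j < k.+3)%N ->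
  @adj (D_graph k.+3) (inord i) (inord j) = (j == i.+1) || (i == 0)%N && (j == 2)%N.
Proof.
move=> /andP[ij jk]; rewrite /= /rel_adj -val_eqE /= !inordK //; last exact: ltn_trans jk.
by lia.
Qed.

Lemma inord_neq k i j : (i < j < k.+3)%N -> inord i != inord j :> 'I_k.+3.
Proof.
move=> /andP[ij jk]; rewrite -val_eqE /= !inordK //; last exact: ltn_trans jk.
by rewrite ltn_eqF.
Qed.

Lemma cycle_graph_shape k : exists (a z x : cycle_graph k.+3) m,
  [/\ cycle_shape a z m x, size m = k & forall w, w \in a :: z :: rcons m x].
Proof.
pose f : nat -> cycle_graph k.+3 := inord.
have E : [seq f i | i <- iota 1 k.+2] = f 1 :: rcons [seq f i | i <- iota 2 k] (f k.+2).
  by rewrite -map_rcons -cats1 -[[:: k.+2]]/(iota (2 + k) 1) -iotaD addn1.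
exists (f 0), (f 1), (f k.+2), [seq f i | i <- iota 2 k]; split; last 2 first.
- by rewrite size_map size_iota.
- by rewrite -E; apply: inord_cover.
split; rewrite -?E.
- apply: induced_path_iota => i j i1 ij jk.
  by rewrite inord_neq ?adj_cycle_graph; [split=> //; lia|lia|lia].
- apply/mapP=> -[i /[!mem_iota] i1 /eqP]; apply/negP; rewrite inord_neq //; lia.
- by rewrite adj_cycle_graph.
- by rewrite adj_cycle_graph ?eqxx ?orbT // ltnSn.
- apply/allP=> _ /mapP[i /[!mem_iota] i2 ->]; rewrite adj_cycle_graph; lia.
Qed.

Lemma D_graph_shape k : exists (a y z : D_graph k.+3) m,
  [/\ D_shape a y z m, size m = k & forall w, w \in a :: y :: z :: m].
Proof.
pose f : nat -> D_graph k.+3 := inord.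
exists (f 0), (f 1), (f 2), [seq f i | i <- iota 3 k]; split; last 2 first.
- by rewrite size_map size_iota.
- exact: (@inord_cover k.+2).
have E : [seq f i | i <- iota 1 k.+2] = [:: f 1, f 2 & [seq f i | i <- iota 3 k]] by [].
split; rewrite -?E.
- apply: induced_path_iota => i j i1 ij jk.
  by rewrite inord_neq ?adj_D_graph; [split=> //; lia|lia|lia].
- apply/mapP=> -[i /[!mem_iota] i1 /eqP]; apply/negP; rewrite inord_neq //; lia.
- by rewrite adj_D_graph.
- by rewrite adj_D_graph.
- apply/allP=> _ /mapP[i /[!mem_iota] i2 ->]; rewrite adj_D_graph; lia.
Qed.

Lemma indep_poly_cover (G : sgraph) (s : seq G) : (forall w, w \in s) ->
  indep_poly G = iseq s.
Proof. by move=> sT; rewrite -ipolT; congr ipol; apply/setP=> w; rewrite !inE sT. Qed.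

Lemma indep_poly_cycle k : indep_poly (cycle_graph k.+3) = cycle_pol k.
Proof.
have [a [z [x [m [c sm sT]]]]] := cycle_graph_shape k.
by rewrite (indep_poly_cover sT) iseq_cycle // sm.
Qed.

Lemma indep_poly_D k : indep_poly (D_graph k.+3) = cycle_pol k.
Proof.
have [a [y [z [m [c sm sT]]]]] := D_graph_shape k.
by rewrite (indep_poly_cover sT) iseq_D // sm.
Qed.

(** * The exceptional graph with the polynomial of the 6-cycle *)

Definition diamond_edge_shape (G : sgraph) (u v a c p q : G) :=
  [/\ diamond_shape u v a c, p != q, adj p q,
      forall x, x \in [:: a; c; u; v] -> x \notin [:: p; q] /\ ~~ adj x p && ~~ adj x q
    & forall x, x \in [:: a; c; u; v; p; q]].

Lemma iso_diamond_edge (G H : sgraph) (u v a c p q : G) (u' v' a' c' p' q' : H) :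
  diamond_edge_shape u v a c p q -> diamond_edge_shape u' v' a' c' p' q' -> iso G H.
Proof.
have U (K : sgraph) (u0 v0 a0 c0 p0 q0 : K) : diamond_edge_shape u0 v0 a0 c0 p0 q0 ->
    uniq [:: a0; c0; u0; v0; p0; q0].
  case=> -[us _ _ _] pq _ sep _; rewrite -[_ :: _]/([:: a0; c0; u0; v0] ++ [:: p0; q0]).
  have [sp sq] : p0 \notin [:: a0; c0; u0; v0] /\ q0 \notin [:: a0; c0; u0; v0].
    by split; apply/negP => /sep[]; rewrite !inE eqxx ?orbT.
  by rewrite cat_uniq us [has _ _]/= (negPf sp) (negPf sq) /= inE pq.
move=> h h'; have us := U _ _ _ _ _ _ _ h; have us' := U _ _ _ _ _ _ _ h'.
case: h => -[_ nac [au av cu cv] uv] pq apq sep sT.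
case: h' => -[_ nac' [au' av' cu' cv'] uv'] pq' apq' sep' sT'.
have nadj x : x \in [:: a; c; u; v] -> (adj x p = false) * (adj x q = false).
  by case/sep=> _ /andP[/negbTE -> /negbTE ->].
have nadj' x : x \in [:: a'; c'; u'; v'] -> (adj x p' = false) * (adj x q' = false).
  by case/sep'=> _ /andP[/negbTE -> /negbTE ->].
have na : (adj a p = false) * (adj a q = false).
  by apply: nadj; rewrite !inE eqxx ?orbT.
have nc : (adj c p = false) * (adj c q = false).
  by apply: nadj; rewrite !inE eqxx ?orbT.
have nu : (adj u p = false) * (adj u q = false).
  by apply: nadj; rewrite !inE eqxx ?orbT.
have nv : (adj v p = false) * (adj v q = false).
  by apply: nadj; rewrite !inE eqxx ?orbT.
have na' : (adj a' p' = false) * (adj a' q' = false).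
  by apply: nadj'; rewrite !inE eqxx ?orbT.
have nc' : (adj c' p' = false) * (adj c' q' = false).
  by apply: nadj'; rewrite !inE eqxx ?orbT.
have nu' : (adj u' p' = false) * (adj u' q' = false).
  by apply: nadj'; rewrite !inE eqxx ?orbT.
have nv' : (adj v' p' = false) * (adj v' q' = false).
  by apply: nadj'; rewrite !inE eqxx ?orbT.
apply: (@iso_of_seqs _ _ a a' [:: a; c; u; v; p; q] [:: a'; c'; u'; v'; p'; q']) => //.
have up i j : (i < j < 6)%N ->
   adj (nth a [:: a; c; u; v; p; q] i) (nth a [:: a; c; u; v; p; q] j) =
   adj (nth a' [:: a'; c'; u'; v'; p'; q'] i) (nth a' [:: a'; c'; u'; v'; p'; q'] j).
  case/andP=> ij j6; case: j j6 ij => [|[|[|[|[|[|j]]]]]] //= _;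
    case: i => [|[|[|[|[|i]]]]] //= _;
    by rewrite ?na ?nc ?nu ?nv ?na' ?nc' ?nu' ?nv' ?(au, av, cu, cv, uv, apq)
      ?(au', av', cu', cv', uv', apq') ?(negPf nac) ?(negPf nac').
move=> i j i6 j6; case: (ltngtP i j) => [ij|ji|->]; last by rewrite !adj_irr.
  by apply: up; rewrite ij.
by rewrite adj_sym [RHS]adj_sym up // ji.
Qed.

(** (1 + 4X + X^2)(1 + 2X) = 1 + 6X + 9X^2 + 2X^3. *)
Lemma indep_poly_diamond_edge (G : sgraph) (u v a c p q : G) :
  diamond_edge_shape u v a c p q -> indep_poly G = cycle_pol 3.
Proof.
case=> d pq apq sep sT; rewrite (indep_poly_cover sT) /iseq.
have -> : [set x in [:: a; c; u; v; p; q]] =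
    [set x in [:: a; c; u; v]] :|: [set x in [:: p; q]].
  by apply/setP=> x; rewrite !inE -!orbA.
rewrite ipolU.
- rewrite -!/(iseq _) (iseq_diamond d) !iseq_cons ?inE //= apq /= iseq_nil /cycle_pol /=; ring.
- move=> x y; rewrite inE => /sep[_ /andP[xp xq]].
  by rewrite !inE => /orP[]/eqP->.
- rewrite -setI_eq0; apply/eqP/setP=> x; rewrite !in_set.
  by apply/negbTE/negP=> /andP[/sep[/negbTE->]].
Qed.

Lemma adj_disjoint_unionl (G H : sgraph) (x y : G) :
  @adj (disjoint_union G H) (inl x) (inl y) = adj x y.
Proof.
rewrite /= /rel_adj (adj_sym y) orbb; case: eqP => // -[->]; by rewrite adj_irr.
Qed.

Lemma adj_disjoint_unionr (G H : sgraph) (x y : H) :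
  @adj (disjoint_union G H) (inr x) (inr y) = adj x y.
Proof.
rewrite /= /rel_adj (adj_sym y) orbb; case: eqP => // -[->]; by rewrite adj_irr.
Qed.

(** The deleted edge joins 0 and 1, the only pair [i < j] with [j] at most 1. *)
Lemma adj_K4_minus_edge i j : (i < j < 4)%N ->
  @adj K4_minus_edge (inord i) (inord j) = (1 < j)%N.
Proof.
move=> /andP[ij j4]; have i4 := ltn_trans ij j4.
have nij : inord i != inord j :> 'I_4 by apply: (@inord_neq 1); rewrite ij.
rewrite /= /rel_adj /= /rel_adj nij (eq_sym (inord j)) nij /= (setUC [set inord j]) orbb.
case: ltnP => j1.
  apply/eqP=> /setP /(_ (inord j)); rewrite !inE eqxx orbT -!val_eqE /= !inordK //.
  by case: j j1 {nij ij j4} => [|[]].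
have [-> ->] : i = 0%N /\ j = 1%N by lia.
by rewrite eqxx.
Qed.

Lemma K4_minus_edge_K2_shape : exists u v a c p q,
  @diamond_edge_shape (disjoint_union K4_minus_edge (complete 2)) u v a c p q.
Proof.
pose l i : disjoint_union K4_minus_edge (complete 2) := inl (inord i).
pose r i : disjoint_union K4_minus_edge (complete 2) := inr (inord i).
have lE i j : (i < j < 4)%N -> adj (l i) (l j) = (1 < j)%N.
  by move=> ij; rewrite adj_disjoint_unionl adj_K4_minus_edge.
have lN i j : (i < j < 4)%N -> l i != l j.
  by move=> ij; have := @inord_neq 1 i j ij; apply: contra => /eqP[->].
have rN : r 0 != r 1.
  by apply/eqP=> -[] /eqP; rewrite -val_eqE /= !inordK.
exists (l 2), (l 3), (l 0), (l 1), (r 0), (r 1); split=> //.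
- split; [|by rewrite lE|by split; rewrite lE|by rewrite lE].
  by rewrite /= !inE !negb_or !lN.
- rewrite adj_disjoint_unionr /= /rel_adj /= andbT; apply: contra rN => /eqP E.
  by rewrite /r E.
- by move=> x; rewrite !inE => /or4P[] /eqP->.
case=> x; rewrite !inE.
  have : x \in inord 0 :: [seq inord i | i <- iota 1 3] by apply: inord_cover.
  rewrite /= !inE => /or4P[] /eqP->; by rewrite eqxx ?orbT.
have : x \in inord 0 :: [seq inord i | i <- iota 1 1] by apply: inord_cover.
by rewrite /= !inE => /orP[] /eqP->; rewrite eqxx ?orbT.
Qed.

(** * The even cycle *)

Section EvenCycle.
Variables (G : sgraph) (j : nat).
(** By the shift in [cycle_pol], the cycle in question has [j.*2.+4] vertices. *)
Hypothesis polyG : indep_poly G = cycle_pol j.*2.+1.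
Implicit Types (A B : {set G}).

Lemma lead_ipol_closed A B : closed_set A -> closed_set B -> A \subset B ->
  lead_coef (ipol B) = lead_coef (ipol A) * lead_coef (ipol (B :\: A)).
Proof. by move=> cA cB AB; rewrite (ipol_closed cA cB AB) lead_coefM. Qed.

Lemma balance_ipol_closed A B : closed_set A -> closed_set B -> A \subset B ->
  balance (ipol B) = balance (ipol A) + balance (ipol (B :\: A)).
Proof.
by move=> cA cB AB; rewrite (ipol_closed cA cB AB) balanceM ?coef0_ipol.
Qed.

Lemma closed_setT : closed_set [set: G].
Proof. by move=> x y; rewrite !inE. Qed.

Lemma lead_ipolT : lead_coef (ipol [set: G]) = 2.
Proof. by rewrite ipolT polyG; have [_ [_ ->]] := deg_lead_cycle j. Qed.

Lemma balance_ipolT : balance (ipol [set: G]) = 0.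
Proof. by rewrite ipolT polyG balance_cycle. Qed.

(** [A] and its complement have positive integer leading coefficients with product 2. *)
Lemma lead_ipol_le2 A : closed_set A -> lead_coef (ipol A) <= 2.
Proof.
move=> cA; have := lead_ipol_closed cA closed_setT (subsetT A).
have := lead_ipol_gt0 A; have := lead_ipol_gt0 ([set: G] :\: A).
by rewrite lead_ipolT; nia.
Qed.

(** Three vertices of degree 2 would form a closed triangle, with leading coefficient 3. *)
Lemma triangle_big (x y z : G) : triangle x y z -> big x || big y || big z.
Proof.
move=> /and3P[xy yz xz]; apply: contraT; rewrite /big !negb_or -!leqNgt.
case/andP=> /andP[dx dy] dz.
have [nxy nyz nxz] : [/\ x != y, y != z & x != z] by rewrite !adj_neq.
have N (a b c : G) : (deg a <= 2)%N -> adj a b -> adj a c -> b != c ->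
    forall w, adj a w = (w \in [:: b; c]).
  move=> da ab ac nbc; apply: nbr_deg => //; first by rewrite /= inE nbc.
  by move=> w; rewrite !inE => /orP[]/eqP->.
have cs : seq_closed [:: x; y; z].
  have Nx := N x y z dx xy xz nyz.
  have Ny := N y x z dy (etrans (adj_sym _ _) xy) yz nxz.
  have Nz := N z x y dz (etrans (adj_sym _ _) xz) (etrans (adj_sym _ _) yz) nxy.
  by move=> u w; rewrite !inE => /or3P[]/eqP->; rewrite ?Nx ?Ny ?Nz !inE => /orP[]/eqP->;
    rewrite eqxx ?orbT.
have c : cycle_shape x y [::] z.
  by split; rewrite //= ?inE ?negb_or ?yz ?nyz ?nxy ?nxz.
have := lead_ipol_le2 (seq_closed_set cs).
rewrite -/(iseq _) -[[:: x; y; z]]/(x :: y :: rcons [::] z) iseq_cycle //.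
by have [[_ ->] _] := deg_lead_cycle 0.
Qed.

Lemma component_exists B (x : G) : closed_set B -> x \in B ->
  exists A, [/\ A \subset B, A != set0, closed_set A & component A].
Proof.
move=> cB xB; have id := degree_triangle_identity polyG.
apply: exists_component xB => //.
- by move=> v; have [] := charge_tight triangle_big id v.
- by move=> v; have [_] := charge_tight triangle_big id v.
- exact: lead_ipol_le2.
Qed.

Definition diamond A := exists u v a c,
  diamond_shape u v a c /\ A = [set w in [:: a; c; u; v]].

Definition edge A := exists p q, [/\ p != q, adj p q & A = [set w in [:: p; q]]].

Definition cycle_or_D A := exists k, ipol A = cycle_pol k /\
  ((exists a z m x, [/\ cycle_shape a z m x, size m = k & A = [set w in a :: z :: rcons m x]]) \/
   (exists a y z m, [/\ D_shape a y z m, size m = k & A = [set w in a :: y :: z :: m]])).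

Lemma cycle_or_D_lead A : cycle_or_D A -> lead_coef (ipol A) <= 2 ->
  lead_coef (ipol A) = 2 /\ balance (ipol A) = 0.
Proof.
move=> [k [-> _]]; rewrite -(odd_double_half k); case: (odd k); rewrite ?add1n ?add0n.
  by have [_ [_ ->]] := deg_lead_cycle k./2; rewrite balance_cycle.
by have [[_ ->] _] := deg_lead_cycle k./2; rewrite ler_nat; lia.
Qed.

Lemma component_cases A : component A -> lead_coef (ipol A) <= 2 ->
  [\/ lead_coef (ipol A) = 1 /\ balance (ipol A) = 3,
      [/\ lead_coef (ipol A) = 1, balance (ipol A) = 2 & diamond A],
      [/\ lead_coef (ipol A) = 2, balance (ipol A) = -2 & edge A] |
      [/\ lead_coef (ipol A) = 2, balance (ipol A) = 0 & cycle_or_D A]].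
Proof.
case=> [s ps s1 ->|a z m x c EA|a y z m c m0 EA|u v a c d ->] le2.
- move: le2; rewrite -/(iseq s) (iseq_path ps).
  have := odd_double_half (size s); case: (odd _); rewrite ?add1n ?add0n => Es.
    rewrite -Es => _; have [_ [_ ->]] := deg_lead_path (size s)./2.
    by apply: Or41; rewrite balance_path_odd.
  (* A path on 2(h+1) vertices has leading coefficient h+2, so only [h = 0], the single edge,
     survives. *)
  have [h Eh] : exists h, (size s)./2 = h.+1.
    by move: Es s1; case: (size s)./2 => [<-//|h]; exists h.
  rewrite -Es Eh; have [[_ ->] _] := deg_lead_path h.+1.
  rewrite ler_nat !ltnS leqn0 => /eqP h0; apply: Or43.
  rewrite balance_path_even h0; split=> //.
  have : size s = 2 by rewrite -Es Eh h0.
  case: s ps {s1 Es Eh} => [|p [|q []]] //= /and3P[/andP[pq _] pN _] _.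
  by exists p, q; split; rewrite ?adj_neq.
- apply: Or44; have cD : cycle_or_D A.
    exists (size m); split; first by rewrite EA -/(iseq _) iseq_cycle.
    by left; exists a, z, m, x.
  by have [-> ->] := cycle_or_D_lead cD le2.
- apply: Or44; have cD : cycle_or_D A.
    exists (size m); split; first by rewrite EA -/(iseq _) iseq_D.
    by right; exists a, y, z, m.
  by have [-> ->] := cycle_or_D_lead cD le2.
- apply: Or42; rewrite -/(iseq _) (iseq_diamond d) balance_diamond.
  by have [_ ->] := deg_lead_diamond; split=> //; exists u, v, a, c.
Qed.

(** Components with leading coefficient 1 have balance 2 or 3, so two of them already give at least
    4. *)
Lemma lead1_balance B : closed_set B -> lead_coef (ipol B) = 1 -> B != set0 ->
  2 <= balance (ipol B) /\ (balance (ipol B) = 2 -> diamond B).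
Proof.
have [n] := ubnP #|B|; elim: n B => // n IH B le_n cB lB /set0Pn[x xB].
have [A [AB A0 cA /component_cases /(_ (lead_ipol_le2 cA)) comp]] := component_exists cB xB.
have eqB := balance_ipol_closed cA cB AB; have := lead_ipol_closed cA cB AB; rewrite lB.
have := lead_ipol_gt0 A; have := lead_ipol_gt0 (B :\: A) => gtR gtA eq1.
have lA : lead_coef (ipol A) = 1 by nia.
have lR : lead_coef (ipol (B :\: A)) = 1 by nia.
have {comp} comp : balance (ipol A) = 3 \/ balance (ipol A) = 2 /\ diamond A.
  by case: comp; rewrite lA => -[] //; [left|right].
case: (eqVneq (B :\: A) set0) => [R0|R0].
  have EB : B = A by apply/eqP; rewrite eqEsubset AB -setD_eq0 R0 eqxx.
  by rewrite EB; case: comp => [->|[-> dA]].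
have lt_n : (#|B :\: A| < n)%N.
  apply: leq_trans (_ : #|B| <= n)%N => //; apply: proper_card.
  rewrite properEneq subsetDl andbT; apply/eqP=> E; case/set0Pn: A0 => y yA.
  by have := subsetP AB y yA; rewrite -E inE yA.
have [ge2 _] := IH _ lt_n (closed_setD cB cA) lR R0.
by rewrite eqB; case: comp => [->|[-> _]]; split; lia.
Qed.

Lemma lead2_component B : closed_set B -> lead_coef (ipol B) = 2 ->
  exists A, [/\ A \subset B, closed_set A, lead_coef (ipol A) = 2 & component A].
Proof.
have [n] := ubnP #|B|; elim: n B => // n IH B le_n cB lB.
have /set0Pn[x xB] : B != set0.
  by apply/eqP=> B0; move: lB; rewrite B0 ipol0 lead_coef1.
have [A [AB A0 cA comp]] := component_exists cB xB.
have lE := lead_ipol_closed cA cB AB; rewrite lB in lE.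
have [lA1|lA2] : lead_coef (ipol A) = 1 \/ lead_coef (ipol A) = 2.
  by case: (component_cases comp (lead_ipol_le2 cA)) => -[->]; [left|left|right|right].
  have lt_n : (#|B :\: A| < n)%N.
    apply: leq_trans (_ : #|B| <= n)%N => //; apply: proper_card.
    rewrite properEneq subsetDl andbT; apply/eqP=> E; case/set0Pn: A0 => y yA.
    by have := subsetP AB y yA; rewrite -E inE yA.
  have lR : lead_coef (ipol (B :\: A)) = 2 by move: lE; rewrite lA1 mul1r.
  have [A' [A'B cA' lA' comp']] := IH _ lt_n (closed_setD cB cA) lR.
  by exists A'; split=> //; apply: subset_trans A'B (subsetDl _ _).
by exists A.
Qed.

Lemma even_cycle_class :
  [\/ iso G (cycle_graph j.*2.+4), iso G (D_graph j.*2.+4) |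
      j = 1%N /\ iso G (disjoint_union K4_minus_edge (complete 2))].
Proof.
have [A [_ cA lA comp]] := lead2_component closed_setT lead_ipolT.
have bT := balance_ipol_closed cA closed_setT (subsetT A); rewrite balance_ipolT in bT.
have := lead_ipol_closed cA closed_setT (subsetT A); rewrite lead_ipolT lA => lR.
have {}lR : lead_coef (ipol ([set: G] :\: A)) = 1 by lia.
have cR := closed_setD closed_setT cA.
have R0E : [set: G] :\: A = set0 -> A = [set: G].
  by move=> R0; apply/eqP; rewrite eqEsubset subsetT -setD_eq0 R0 eqxx.
case: (component_cases comp (lead_ipol_le2 cA)); rewrite lA => -[] // _ bA.
(* The total balance is 0, so the -2 of the edge must be met by exactly 2 in the remainder. *)
- move=> [p [q [npq pq EA]]]; rewrite bA in bT.
  case: (eqVneq ([set: G] :\: A) set0) => [R0|R0].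
    by move: bT; rewrite R0 ipol0 balance1.
  have [_ dR] := lead1_balance cR lR R0.
  have [u [v [a [c [d ER]]]]] : diamond ([set: G] :\: A) by apply: dR; lia.
  have sh : diamond_edge_shape u v a c p q.
    have inR x : (x \in [:: a; c; u; v]) = (x \notin A).
      by have /setP/(_ x) := ER; rewrite !in_set andbT => ->.
    have inA x : (x \in A) = (x \in [:: p; q]) by rewrite EA inE.
    split=> // x.
      rewrite inR => xA; rewrite -inA; split=> //.
      by apply/andP; split; apply: contra xA; rewrite adj_sym; apply: cA;
        rewrite inA !inE eqxx ?orbT.
    rewrite -[_ :: _]/([:: a; c; u; v] ++ [:: p; q]) mem_cat inR -inA.
    by case: (x \in A).
  apply: Or33; split; last first.
    by have [u' [v' [a' [c' [p' [q' sh']]]]]] := K4_minus_edge_K2_shape;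
      apply: iso_diamond_edge sh sh'.
  (* The coefficient of X is the number of vertices, which pins down [j]. *)
  have := indep_poly_diamond_edge sh; rewrite polyG => /(congr1 (fun P : {poly int} => P`_1)).
  by rewrite !coef1_cycle; lia.
- rewrite bA in bT => -[k [EA sh]].
  (* A nonempty remainder would have balance 0, below the minimum 2. *)
  have AT : A = [set: G].
    apply: R0E; apply/eqP; apply: contraT => R0.
    by have [] := lead1_balance cR lR R0; lia.
  have kE : k = j.*2.+1.
    move: EA; rewrite AT ipolT polyG => /(congr1 (fun P : {poly int} => P`_1)).
    by rewrite !coef1_cycle; lia.
  case: sh => [[a [z [m [x [c sm Es]]]]]|[a [y [z [m [c sm Es]]]]]].
    have [a' [z' [x' [m' [c' sm' sT']]]]] := cycle_graph_shape j.*2.+1.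
    apply: Or31; apply: iso_cycle_shape c c' _ _ sT'; first by rewrite sm sm'.
    by move=> w; have : w \in A by [rewrite AT inE]; rewrite Es in_set.
  have [a' [y' [z' [m' [c' sm' sT']]]]] := D_graph_shape j.*2.+1.
  apply: Or32; apply: iso_D_shape c c' _ _ sT'; first by rewrite sm sm'.
  by move=> w; have : w \in A by [rewrite AT inE]; rewrite Es in_set.
Qed.

End EvenCycle.

Local Open Scope nat_scope.

Theorem theorem11 :
  (forall H : sgraph,
     indep_class (cycle_graph 6) H <->
     [\/ iso H (cycle_graph 6),
         iso H (D_graph 6) |
         iso H (disjoint_union K4_minus_edge (complete 2))]) /\
  (forall n : nat, 2 <= n -> n <> 3 ->
     forall H : sgraph,
       indep_class (cycle_graph (2 * n)) H <->
       (iso H (cycle_graph (2 * n)) \/ iso H (D_graph (2 * n)))).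
Proof.
have fwd j H : iso H (cycle_graph j.*2.+4) \/ iso H (D_graph j.*2.+4) ->
    indep_class (cycle_graph j.*2.+4) H.
  rewrite /indep_class indep_poly_cycle.
  by case=> /iso_indep_poly ->; rewrite ?indep_poly_cycle ?indep_poly_D.
split=> [H|n n2 n3 H].
  split=> [HC|].
    have polyH : indep_poly H = cycle_pol 1.*2.+1 by rewrite -indep_poly_cycle.
    by case: (even_cycle_class polyH) => [||[_]]; [constructor 1|constructor 2|constructor 3].
  case=> h; [by apply: (fwd 1%N); left|by apply: (fwd 1%N); right|].
  rewrite /indep_class (iso_indep_poly h) indep_poly_cycle.
  have [u [v [a [c [p [q sh]]]]]] := K4_minus_edge_K2_shape.
  exact: indep_poly_diamond_edge sh.
(* With [j = n - 2], the exceptional value [j = 1] is the excluded [n = 3]. *)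
have -> : (2 * n)%N = (n - 2).*2.+4 by lia.
split=> [HC|]; last exact: fwd.
have polyH : indep_poly H = cycle_pol (n - 2).*2.+1 by rewrite -indep_poly_cycle.
case: (even_cycle_class polyH) => [||[n1 _]]; [by left|by right|by lia].
Qed.
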